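(* Let $p>2$ be a prime, let $n,k$ be natural numbers, and let $G$ be a finite abelian group of order $p^n$ with $p^{k(p-1)}G=0$. Then there is a formal term $t(X,Y)$ (in the sense of the context), depending only on the abelian group $G$ (and on $p,k$ and the fixed integer $\gamma$), such that the following holds for every brace $(A,+,\circ)$ with additive group $(A,+)=G$ satisfying Properties $1'$ and $1''$. The structure $(P,+,\bullet)$ with $P=A/ann(p^{2k})$ is a left nilpotent pre-Lie ring, and the brace $Q=A/ann(p^{4k})$ is obtained from $(P,+,\bullet)$ by the formula $t$: the addition of $Q$ is the one induced from $P$, and for all $x,y\in P$ and all choices of division functions $\rho^{-1}$ the value $t(x,y)$ is defined, lies in $Q$ and satisfies $$\bar x*\bar y=t(x,y)\quad\text{in } Q,$$ where $\bar x,\bar y$ denote the images of $x,y$ in $Q$.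
   Context: A (left) brace is a set $A$ with operations $+,\circ$ such that $(A,+)$ is an abelian group, $(A,\circ)$ is a group and $a\circ(b+c)+a=a\circ b+a\circ c$ for all $a,b,c$. Put $a*b=a\circ b-a-b$. An ideal is an additive subgroup $I$ with $i*a,\,a*i\in I$ for all $i\in I,a\in A$; then $A/I$ is a brace. Write $p^iA=\{p^ia:a\in A\}$ and $ann(p^i)=\{a\in A:p^ia=0\}$. Let $m=\lfloor (p-1)/4\rfloor$. Property $1'$: for all $a,b\in A$, $a*(a*(\cdots*(a*b)\cdots))\in pA$ with $a$ appearing $m$ times, and $a*(a*(\cdots*(a*a)\cdots))\in pA$ with $a$ appearing $m$ times in total (for $m=0$ the first condition reads $b\in pA$ and the second is void). Property $1''$: for all $a\in A$, $i\ge 1$, $c\in ann(p^i)$, $a*(a*(\cdots*(a*c)\cdots))\in ann(p^{i-1})$ with $a$ appearing $m$ times. For braces of order $p^n$ satisfying both properties the sets $p^iA$ and $ann(p^i)$ are ideals. A pre-Lie ring $(L,+,\cdot)$ is an abelian group with a biadditive operation satisfying $(x\cdot y)\cdot z-x\cdot(y\cdot z)=(y\cdot x)\cdot z-y\cdot(x\cdot z)$. It is left nilpotent if for some $N$ all products $x_1\cdot(x_2\cdot(\cdots(x_{N-1}\cdot x_N)\cdots))$ vanish. Operations on $P=A/ann(p^{2k})$: write $[a]$ for the class of $a$ in $P$. Fix $\wp^{-1}:p^kA\to A$ with $p^k\wp^{-1}(x)=x$ for all $x\in p^kA$. Put $[x]\odot[y]=[\wp^{-1}((p^kx)*y)]$.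 Fix a primitive root $\gamma$ modulo $p^n$, put $\xi=\gamma^{p^{n-1}}$, and define $[x]\bullet[y]=\sum_{i=0}^{p-2}\xi^{p-1-i}\,([\xi^ix]\odot[y])$. (These do not depend on the choices of $\wp^{-1}$ or of representatives.) Formal terms: identify $Q=A/ann(p^{4k})$ with $P/ann_P(p^{2k})$, where $ann_P(p^{2k})=\{x\in P:p^{2k}x=0\}$. A division function on an abelian group $H$ is a function $\rho^{-1}:pH\to H$ with $p\rho^{-1}(z)=z$ for all $z\in pH$. A formal term $t(X,Y)$ is a finite expression built from variables $X,Y$ (ranging over $P$) using addition in $P$, addition in $Q$, the operation $\bullet$ on $P$, division functions $\rho^{-1}$ on $P$ and on $Q$, and the operation of taking cosets $P\to Q$. The value is defined if every occurrence of $\rho^{-1}$ is applied to an element divisible by $p$ in the group concerned. *)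

(* Defs.v *)
From HB Require Import structures.
From mathcomp Require Import all_boot all_algebra.

Set Implicit Arguments.
Unset Strict Implicit.
Unset Printing Implicit Defensive.

Import GRing.Theory.
Local Open Scope ring_scope.
Local Open Scope quotient_scope.

Record is_group_law (T : Type) (op : T -> T -> T) : Prop := IsGroupLaw {
  group_lawA : associative op;
  group_law_unit : exists e : T,
    [/\ left_id e op, right_id e op &
        forall x, exists y, op y x = e /\ op x y = e] }.

Record is_brace (A : zmodType) (circ : A -> A -> A) : Prop := IsBrace {
  brace_group : is_group_law circ;
  brace_compat : forall a b c : A, circ a (b + c) + a = circ a b + circ a c }.

Definition star (A : zmodType) (circ : A -> A -> A) (a b : A) : A :=
  circ a b - a - b.

Definition divisible (A : zmodType) (N : nat) (x : A) : Prop :=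
  exists y : A, x = y *+ N.

(* [rho] stands for a function [N A -> A]; it is totalised, and its values
   outside [N A] are irrelevant. *)
Definition division_function (A : zmodType) (N : nat) (rho : A -> A) : Prop :=
  forall z : A, divisible N z -> rho z *+ N = z.

Definition ann (A : zmodType) (N : nat) : {pred A} := [pred x : A | x *+ N == 0].
Arguments ann A N : clear implicits.

Lemma ann_zmod_closed (A : zmodType) (N : nat) : zmod_closed (ann A N).
Proof.
split=> [|x y]; rewrite !inE ?mul0rn // => /eqP x0 /eqP y0.
by rewrite mulrnBl x0 y0 subrr.
Qed.

HB.instance Definition _ (A : zmodType) (N : nat) :=
  GRing.isZmodClosed.Build A (ann A N) (ann_zmod_closed A N).

Definition quot_ann (A : zmodType) (N : nat) : zmodType :=
  Quotient.quot (ann A N : zmodClosed A).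

Definition cls (A : zmodType) (N : nat) (a : A) : quot_ann A N :=
  \pi_(Quotient.quot (ann A N : zmodClosed A)) a.

Definition rep (A : zmodType) (N : nat) (u : quot_ann A N) : A :=
  repr (u : Quotient.quot (ann A N : zmodClosed A)).

(* The map [A/ann(M) -> A/ann(N)], meaningful for [M %| N]. *)
Definition coset (A : zmodType) (M N : nat) (u : quot_ann A M) : quot_ann A N :=
  cls N (rep u).

(* The operation induced by [circ] on [A/ann(N)]. *)
Definition quot_circ (A : zmodType) (circ : A -> A -> A) (N : nat)
    (u v : quot_ann A N) : quot_ann A N :=
  cls N (circ (rep u) (rep v)).

Section QuotientFacts.
Variable A : zmodType.
Implicit Types (M N : nat) (a b : A).

Lemma repK N : cancel (@rep A N) (@cls A N).
Proof. by move=> u; rewrite /cls /rep reprK. Qed.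

Lemma clsD N : {morph @cls A N : a b / a + b}.
Proof. by move=> a b; rewrite /cls raddfD. Qed.

Lemma cls_eq N a b : (cls N a == cls N b) = ((a - b) *+ N == 0).
Proof. by rewrite /cls -Quotient.idealrBE inE. Qed.

Lemma coset_cls M N a : (M %| N)%N -> coset N (cls M a) = cls N a.
Proof.
case/dvdnP=> q ->; apply/eqP; rewrite cls_eq mulnC mulrnA.
by have /eqP := repK (cls M a); rewrite cls_eq => /eqP ->; rewrite mul0rn.
Qed.

Lemma cosetD M N : (M %| N)%N ->
  {morph @coset A M N : u v / u + v}.
Proof.
move=> dvMN u v; rewrite -[u]repK -[v]repK -clsD !coset_cls //; exact: clsD.
Qed.

Lemma coset_surj M N (w : quot_ann A N) : (M %| N)%N ->
  exists u : quot_ann A M, coset N u = w.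
Proof. by move=> dvMN; exists (cls M (rep w)); rewrite coset_cls // repK. Qed.

(* [A/ann(M L) = P/ann_P(L)] for [P = A/ann(M)]. *)
Lemma coset_ker M L (u : quot_ann A M) :
  (coset (M * L) u == 0) = (u \in ann (quot_ann A M) L).
Proof.
have cls0 N : cls N 0 = 0 :> quot_ann A N by rewrite /cls raddf0.
have clsMn N a : cls N a *+ L = cls N (a *+ L) by rewrite /cls raddfMn.
rewrite -[u]repK coset_cls ?dvdn_mulr // -cls0 cls_eq subr0 inE clsMn.
by rewrite -cls0 cls_eq subr0 -mulrnA mulnC.
Qed.

End QuotientFacts.

Definition property1' (p : nat) (A : zmodType) (circ : A -> A -> A) : Prop :=
  let m := (p.-1 %/ 4)%N in
  (forall a b : A, divisible p (iter m (star circ a) b)) /\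
  ((0 < m)%N -> forall a : A, divisible p (iter m.-1 (star circ a) a)).

Definition property1'' (p : nat) (A : zmodType) (circ : A -> A -> A) : Prop :=
  let m := (p.-1 %/ 4)%N in
  forall (a : A) (i : nat), (1 <= i)%N -> forall c : A, c \in ann A (p ^ i) ->
    iter m (star circ a) c \in ann A (p ^ i.-1).

Record is_pre_lie_ring (L : zmodType) (dot : L -> L -> L) : Prop := IsPreLieRing {
  pre_lieDl : forall x y z : L, dot (x + y) z = dot x z + dot y z;
  pre_lieDr : forall x y z : L, dot x (y + z) = dot x y + dot x z;
  pre_lie_assoc : forall x y z : L,
    dot (dot x y) z - dot x (dot y z) = dot (dot y x) z - dot y (dot x z) }.

(* [foldr dot x [:: x_1; ...; x_N]] is the right-normed product
   [x_1 (x_2 (... (x_N x)))] of [N + 1] elements. *)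
Definition left_nilpotent (L : zmodType) (dot : L -> L -> L) : Prop :=
  exists N : nat, forall (s : N.-tuple L) (x : L), foldr dot x s = 0.

Definition primitive_root_mod (N : nat) (g : int) : Prop :=
  coprimez g N /\
  forall a : int, coprimez a N -> exists j : nat, (a = g ^+ j %[mod N])%Z.

(* Computed on the canonical representatives chosen by [rep]; that the choice is
   immaterial is a property of the braces under consideration. *)
Definition odot (p k : nat) (A : zmodType) (circ : A -> A -> A) (wpinv : A -> A)
    (u v : quot_ann A (p ^ (2 * k))) : quot_ann A (p ^ (2 * k)) :=
  cls (p ^ (2 * k)) (wpinv (star circ (rep u *+ p ^ k) (rep v))).

Definition bullet (p k : nat) (xi : int) (A : zmodType) (circ : A -> A -> A)
    (wpinv : A -> A) (u v : quot_ann A (p ^ (2 * k))) :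
    quot_ann A (p ^ (2 * k)) :=
  \sum_(i < p.-1) odot circ wpinv (u *~ (xi ^+ i)) v *~ (xi ^+ (p.-1 - i)).

Inductive termP : Type :=
  | VarX | VarY
  | AddP of termP & termP
  | MulP of termP & termP
  | DivP of termP.

(* Terms with value in [Q], i.e. the formal terms [t(X, Y)]. *)
Inductive termQ : Type :=
  | CosetQ of termP
  | AddQ of termQ & termQ
  | DivQ of termQ.

Section TermSemantics.
Variables (p : nat) (P Q : zmodType) (mul : P -> P -> P) (proj : P -> Q).
Variables (rhoP : P -> P) (rhoQ : Q -> Q) (x y : P).

Fixpoint valP (t : termP) : P :=
  match t with
  | VarX => x
  | VarY => y
  | AddP t1 t2 => valP t1 + valP t2
  | MulP t1 t2 => mul (valP t1) (valP t2)
  | DivP t1 => rhoP (valP t1)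
  end.

Fixpoint valQ (t : termQ) : Q :=
  match t with
  | CosetQ t1 => proj (valP t1)
  | AddQ t1 t2 => valQ t1 + valQ t2
  | DivQ t1 => rhoQ (valQ t1)
  end.

Fixpoint definedP (t : termP) : Prop :=
  match t with
  | VarX | VarY => True
  | AddP t1 t2 | MulP t1 t2 => definedP t1 /\ definedP t2
  | DivP t1 => definedP t1 /\ divisible p (valP t1)
  end.

Fixpoint definedQ (t : termQ) : Prop :=
  match t with
  | CosetQ t1 => definedP t1
  | AddQ t1 t2 => definedQ t1 /\ definedQ t2
  | DivQ t1 => definedQ t1 /\ divisible p (valQ t1)
  end.

End TermSemantics.

(* Main.v *)
From mathcomp Require Import all_boot all_fingroup all_algebra all_solvable.
From mathcomp Require Import finfield zify ring.
Require Import Defs.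

Set Implicit Arguments.
Unset Strict Implicit.
Unset Printing Implicit Defensive.

Import GRing.Theory Num.Theory.
Local Open Scope ring_scope.

(** The brace and the pre-Lie ring are related as a Lie group and its Lie
    algebra. Write $L_a(v) = a * v$ and $\lambda_a = 1 + L_a$; then
    $a \mapsto \lambda_a$ is an action of the circle group. Properties $1'$ and
    $1''$ say that $L_a^m$ is divisible by $p$ as an endomorphism, where
    $4m \le p - 1$, so the series $\log(1 + L_a)$ and $\log(1 + L_a)/L_a$ make
    sense although the number of terms exceeds $p$: by Legendre's bound the
    powers of $L_a$ absorb the denominators. This gives a logarithm
    $\omega(a) = \log(1 + L_a)/L_a (a)$ of an element ([log_elt]) and the
    logarithm $\tau_a = \log \lambda_a$ of its action ([log_act]).

    On the other side, $p^k x$ acts by operators divisible by $p^k$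
    ([Fil_star]), and elements of order $p^i$ act by operators killed by $p^i$
    ([star_ann]). Hence $t \mapsto L_{p^k t x}$ is a polynomial whose
    coefficient of $t^a$ is divisible by $p^{ka}$, and it has degree at most
    $p - 2$ because $p^{k(p-1)} G = 0$. The sum over the roots of unity in the
    definition of the product of $P$ extracts $p - 1$ times its linear
    coefficient $D_x$ ([linear_part]). More generally the action along a family
    of elements that is polynomial in this sense is again such a polynomial,
    and its linear coefficient is seen by the linear coefficient of the family
    ([analytic_op_Phi], [avg_Phi]). From this chain rule and the homomorphism
    property of the action follow the additivity of $D$ and, by averaging over
    two variables, the left symmetry of $D_x D_y - D_{D_x y}$
    ([linear_part_symmetric]); dividing by $p^{2k}$ gives the pre-Lie ring.

    Applied to the path $t \mapsto a^{\circ p^k t}$, the chain rule gives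
    $D_{\omega(a)} = (p - 1) p^k \tau_a$ ([linear_part_log_elt]): in $P$, the
    class of $\omega(a)$ multiplies by $(p - 1) \tau_a$. The formal identity
    $e^{\log(1 + X)} = 1 + X$, evaluated at $L_a$ ([exp_log_div]), now recovers
    both $a = ((e^T - 1)/T)(\omega(a))$ and $L_a = ((e^T - 1)/T) T$ from
    $T = \tau_a$. In $(e^T - 1)/T$ only the division by $p$ in $T^{2m}/p$ is
    needed; performed as $T^m p^{-1} T^m$ it is unambiguous, as $T^m$ kills
    what is ambiguous. Finally the term needs $\omega(a)$, while its variable
    gives $a$. The map $\omega$ is injective on the finite group $P$, since $a$
    is recovered from $\omega(a)$ by a term; so it is a permutation of $P$, and
    $\omega$ itself is a power of the term for its inverse, with an exponent
    that depends on $G$ only. *)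

(** * Additive maps and divisibility *)

(** Additivity as a predicate on plain functions: the operators below are
    composed, averaged and divided before they are known to be additive. *)
Definition addf (V W : zmodType) (f : V -> W) := forall x y, f (x + y) = f x + f y.

Section AdditiveMaps.
Variables (V W : zmodType) (f : V -> W).
Hypothesis fD : addf f.

Lemma addf0 : f 0 = 0.
Proof. by apply: (addrI (f 0)); rewrite -fD !addr0. Qed.

Lemma addfN x : f (- x) = - f x.
Proof. by apply: (addrI (f x)); rewrite -fD !subrr addf0. Qed.

Lemma addfB x y : f (x - y) = f x - f y.
Proof. by rewrite fD addfN. Qed.

Lemma addfMn x d : f (x *+ d) = f x *+ d.
Proof. by elim: d => [|d IH]; rewrite ?mulr0n ?addf0 // !mulrS fD IH. Qed.

Lemma addfMz x z : f (x *~ z) = f x *~ z.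
Proof. by case: z => d; rewrite ?NegzE ?mulrNz ?addfN -!pmulrn addfMn. Qed.

Lemma addf_sum I (r : seq I) P (F : I -> V) :
  f (\sum_(i <- r | P i) F i) = \sum_(i <- r | P i) f (F i).
Proof. by apply: (big_morph f fD addf0). Qed.

Lemma addf_divisible N x : divisible N x -> divisible N (f x).
Proof. by case=> y ->; exists (f y); rewrite addfMn. Qed.

End AdditiveMaps.

Section Divisible.
Variable V : zmodType.
Implicit Types x y : V.

Lemma divisible0 N : divisible N (0 : V).
Proof. by exists 0; rewrite mul0rn. Qed.

Lemma divisibleD N x y : divisible N x -> divisible N y -> divisible N (x + y).
Proof. by move=> [u ->] [v ->]; exists (u + v); rewrite mulrnDl. Qed.

Lemma divisibleN N x : divisible N x -> divisible N (- x).
Proof. by move=> [u ->]; exists (- u); rewrite mulNrn. Qed.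

Lemma divisibleMn N x d : divisible N x -> divisible N (x *+ d).
Proof. by move=> [u ->]; exists (u *+ d); rewrite mulrnAC. Qed.

Lemma divisible_mul N d x : divisible N x -> divisible (N * d) (x *+ d).
Proof. by move=> [u ->]; exists u; rewrite mulrnA. Qed.

Lemma divisible_dvd N M x : (N %| M)%N -> divisible M x -> divisible N x.
Proof.
by move=> /dvdnP[q ->] [u ->]; exists (u *+ q); rewrite -mulrnA.
Qed.

Lemma divisible_sum N I (r : seq I) (P : pred I) (F : I -> V) :
  (forall i, P i -> divisible N (F i)) -> divisible N (\sum_(i <- r | P i) F i).
Proof.
by move=> H; elim/big_ind: _ => //; [exact: divisible0|move=> x y; exact: divisibleD].
Qed.

End Divisible.

Lemma addf_iter (V : zmodType) (f : V -> V) i : addf f -> addf (iter i f).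
Proof. by move=> fD; elim: i => [|i IH] x y //=; rewrite IH fD. Qed.

Lemma addf_comp (U V W : zmodType) (f : V -> W) (g : U -> V) :
  addf f -> addf g -> addf (fun x => f (g x)).
Proof. by move=> fD gD x y; rewrite gD fD. Qed.

Section Filtration.
Variables (G : zmodType) (p : nat).
Implicit Types (f g : G -> G).

(** Divisibility of an endomorphism by $p^j$, expressed on elements so that no
    quotient has to be chosen: it maps into $p^j G$, and it lowers the exponent
    of annihilators by [j]. Properties $1'$ and $1''$ put $L_a^m$ at level
    [1]. *)
Definition Fil j f :=
  [/\ addf f, forall x, divisible (p ^ j) (f x) &
      forall i c, c *+ p ^ (i + j) = 0 -> f c *+ p ^ i = 0].

Lemma Fil_addf j f : Fil j f -> addf f. Proof. by case. Qed.

Lemma Fil_ext j f g : f =1 g -> Fil j f -> Fil j g.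
Proof.
move=> e [fD fd fa]; split=> [x y|x|i c c0]; rewrite -!e //; exact: fa.
Qed.

Lemma Fil0 f : addf f -> Fil 0 f.
Proof.
move=> fD; split=> // [x|i c]; first by exists (f x).
by rewrite addn0 -addfMn // => ->; rewrite addf0.
Qed.

Lemma Fil_zero j : Fil j (fun _ => 0).
Proof.
split=> [x y|x|i c _]; [by rewrite addr0|exact: divisible0|by rewrite mul0rn].
Qed.

Lemma Fil_le i j f : (i <= j)%N -> Fil j f -> Fil i f.
Proof.
move=> ij [fD fd fa]; split=> // [x|l c c0].
  by apply: divisible_dvd (fd x); rewrite dvdn_exp2l.
have [jl|lj] := leqP (j - i) l; last first.
  have: f c *+ p ^ 0 = 0.
    apply: fa; rewrite add0n -(subnK (_ : l + i <= j)%N); last by lia.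
    by rewrite addnC expnD mulrnA c0 mul0rn.
  by rewrite expn0 mulr1n => ->; rewrite mul0rn.
have: f c *+ p ^ (l - (j - i)) = 0.
  by apply: fa; rewrite (_ : (l - (j - i) + j = l + i)%N) //; lia.
by move=> e; rewrite -(subnK jl) expnD mulrnA e mul0rn.
Qed.

Lemma FilD j f g : Fil j f -> Fil j g -> Fil j (fun x => f x + g x).
Proof.
move=> [fD fd fa] [gD gd ga]; split=> [x y|x|i c c0].
- by rewrite fD gD addrACA.
- exact: divisibleD.
- by rewrite mulrnDl fa // ga // addr0.
Qed.

Lemma FilN j f : Fil j f -> Fil j (fun x => - f x).
Proof.
move=> [fD fd fa]; split=> [x y|x|i c c0].
- by rewrite fD opprD.
- exact: divisibleN.
- by rewrite mulNrn fa // oppr0.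
Qed.

Lemma FilMn j f d : Fil j f -> Fil j (fun x => f x *+ d).
Proof.
move=> [fD fd fa]; split=> [x y|x|i c c0].
- by rewrite fD mulrnDl.
- exact: divisibleMn.
- by rewrite mulrnAC fa // mul0rn.
Qed.

Lemma FilMz j f d : Fil j f -> Fil j (fun x => f x *~ d).
Proof.
move=> Ff; case: d => d; rewrite ?NegzE.
  by apply: Fil_ext (FilMn d Ff) => x; rewrite -pmulrn.
by apply: Fil_ext (FilN (FilMn d.+1 Ff)) => x; rewrite mulrNz -pmulrn.
Qed.

Lemma Fil_pMn i j f : Fil j f -> Fil (i + j) (fun x => f x *+ p ^ i).
Proof.
move=> [fD fd fa]; split=> [x y|x|l c c0].
- by rewrite fD mulrnDl.
- by rewrite addnC expnD; apply: divisible_mul.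
- by rewrite -mulrnA -expnD; apply: fa; rewrite (_ : (i + l + j = l + (i + j))%N) //; lia.
Qed.

Lemma Fil_comp i j f g : Fil i f -> Fil j g -> Fil (i + j) (fun x => f (g x)).
Proof.
move=> [fD fd fa] [gD gd ga]; split=> [x y|x|l c c0].
- by rewrite gD fD.
- have [y ->] := gd x; rewrite addfMn // expnD; exact: divisible_mul.
- by apply: fa; apply: ga; rewrite -addnA.
Qed.

Lemma Fil_sum j I (r : seq I) (P : pred I) (F : I -> G -> G) :
  (forall i, P i -> Fil j (F i)) -> Fil j (fun x => \sum_(i <- r | P i) F i x).
Proof.
move=> H; elim: r => [|i r IH].
  by apply: Fil_ext (Fil_zero j) => x; rewrite big_nil.
case Pi: (P i); last by apply: Fil_ext IH => x; rewrite big_cons Pi.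
by apply: Fil_ext (FilD (H i Pi) IH) => x; rewrite big_cons Pi.
Qed.

Lemma Fil_divisible i j f x :
  Fil j f -> divisible (p ^ i) x -> divisible (p ^ (i + j)) (f x).
Proof.
move=> [fD fd fa] [y ->]; rewrite addfMn // addnC expnD.
by apply: divisible_mul; apply: fd.
Qed.

Lemma Fil_iterM i j f : Fil j f -> Fil (i * j) (iter i f).
Proof.
move=> Ff; elim: i => [|i IH]; first by rewrite mul0n; apply: Fil0.
by rewrite mulSn; exact: (Fil_comp Ff IH).
Qed.

Lemma Fil_iter m i j f : addf f -> Fil 1 (iter m f) -> (m * j <= i)%N ->
  Fil j (iter i f).
Proof.
move=> fD Fm le.
have F1 : Fil j (iter (m * j) f).
  elim: j {le} => [|j IH]; first by rewrite muln0; apply: Fil0.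
  rewrite mulnS -add1n; apply: Fil_ext (Fil_comp Fm IH) => x.
  by rewrite -iterD.
rewrite -(addn0 j) -(subnKC le); apply: Fil_ext (Fil_comp F1 (Fil0 (addf_iter (i - m * j) fD))) => x.
by rewrite -iterD.
Qed.

End Filtration.

(** * Valuations of binomial coefficients *)

Section Numerics.
Variable p : nat.
Hypothesis p_prime : prime p.
Let p_gt0 : (0 < p)%N := prime_gt0 p_prime.

Lemma ltn_mul_pred_exp v : (v * p.-1 < p ^ v)%N.
Proof.
elim: v => // v IH; rewrite expnS.
have : (0 < p ^ v)%N by rewrite expn_gt0 p_gt0.
by move: IH p_gt0; move: (p ^ v)%N => w; nia.
Qed.

(** With $v = v_p(i) \ge 1$ and $m = \lfloor (p-1)/4 \rfloor$ we have
    $m(v + 1) \le 4mv \le v(p - 1) < p^v \le i$. *)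
Lemma leq_logn_quarter i : (0 < i)%N -> (p %| i)%N ->
  (p.-1 %/ 4 * (logn p i).+1 <= i.-1)%N.
Proof.
move=> i0 pi.
have v1 : (0 < logn p i)%N by rewrite logn_gt0 mem_primes p_prime i0.
have le_i : (p ^ logn p i <= i)%N by apply: dvdn_leq => //; apply: pfactor_dvdnn.
have lt_v := ltn_mul_pred_exp (logn p i).
have q4 := leq_trunc_div p.-1 4.
suff : (p.-1 %/ 4 * (logn p i).+1 <= logn p i * p.-1)%N by lia.
move: (p.-1 %/ 4)%N q4 => q q4.
apply: (@leq_trans (logn p i * (q * 4))%N); last by rewrite leq_mul2l q4 orbT.
by move: v1; move: (logn p i) => v; nia.
Qed.

Lemma leq_logn_div i : (0 < i)%N -> (p.-1 %/ 4 * logn p i <= i)%N.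
Proof.
move=> i0; have [pi|pi] := boolP (p %| i)%N.
  by have := leq_logn_quarter i0 pi; rewrite mulnS; lia.
by rewrite (_ : logn p i = 0)%N ?muln0 //; apply/eqP; rewrite -leqn0 leqNgt logn_gt0 mem_primes p_prime i0.
Qed.

(** From $i \binom{p^j}{i} = p^j \binom{p^j - 1}{i - 1}$. *)
Lemma dvdn_bin_exp j i : (0 < i)%N -> (p ^ (j - logn p i) %| 'C(p ^ j, i))%N.
Proof.
move=> i0; have [vj|jv] := leqP (logn p i) j; last first.
  by rewrite (_ : j - logn p i = 0)%N ?dvd1n //; lia.
have [u cu iE] := pfactor_coprime p_prime i0.
have dv : (p ^ j %| u * (p ^ logn p i * 'C(p ^ j, i)))%N.
  have := mul_bin_diag (p ^ j) i.-1; rewrite prednK // mulnA -iE => <-.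
  exact: dvdn_mulr.
have : (p ^ logn p i * p ^ (j - logn p i) %| p ^ logn p i * 'C(p ^ j, i))%N.
  by rewrite -expnD subnKC //; rewrite -(@Gauss_dvdr _ u) // coprimeXl.
by rewrite dvdn_pmul2l // expn_gt0 p_gt0.
Qed.

End Numerics.

Lemma iter_add_binomial (V : zmodType) (L : V -> V) s v : addf L ->
  iter s (fun w => w + L w) v = \sum_(i < s.+1) iter i L v *+ 'C(s, i).
Proof.
move=> LD; elim: s => [|s IH]; first by rewrite big_ord_recl big_ord0 bin0 addr0.
rewrite iterS IH addf_sum // [RHS]big_ord_recl /= bin0.
under [X in _ = _ + X]eq_bigr => i _ do rewrite /bump /= add1n binS mulrnDr.
rewrite big_split /= addrA; congr (_ + _); last first.
  by apply: eq_bigr => i _; rewrite addfMn.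
by rewrite [LHS]big_ord_recl bin0 [in RHS]big_ord_recr /= (bin_small (ltnSn s)) mulr0n addr0.
Qed.

(** * A flag of subgroups *)

Section Flag.
Variables (G : finZmodType) (p n : nat) (lam : G -> G -> G) (circ : G -> G -> G).
Hypothesis p_prime : prime p.
Hypothesis cardG : #|G| = (p ^ n)%N.
Hypothesis lamD : forall a, addf (lam a).
Hypothesis lam0 : forall v, lam 0 v = v.
Hypothesis lamM : forall a b v, lam (circ a b) v = lam a (lam b v).
Hypothesis lam_inj : forall a, injective (lam a).
Hypothesis lam_unip : forall a, exists e, forall v, iter (p ^ e) (lam a) v = v.

Let tr (v : G) : {perm G} := perm (addIr v).
Let lp (a : G) : {perm G} := perm (@lam_inj a).

Let trE v x : tr v x = x + v. Proof. by rewrite permE. Qed.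
Let lpE a x : lp a x = lam a x. Proof. by rewrite permE. Qed.

Let trM u v : (tr u * tr v)%g = tr (u + v).
Proof. by apply/permP=> x; rewrite permM !trE addrA. Qed.

Let trV v : (tr v)^-1%g = tr (- v).
Proof.
apply/eqP; rewrite eq_invg_mul trM subrr; apply/eqP/permP=> x.
by rewrite trE perm1 addr0.
Qed.

Let lpM a b : (lp a * lp b)%g = lp (circ b a).
Proof. by apply/permP=> x; rewrite permM !lpE lamM. Qed.

Let tr_group : group_set [set tr v | v : G].
Proof.
apply/group_setP; split=> [|_ _ /imsetP[u _ ->] /imsetP[v _ ->]].
  apply/imsetP; exists 0 => //; apply/permP=> x; by rewrite trE perm1 addr0.
by rewrite trM; apply: imset_f.
Qed.

Let lp_group : group_set [set lp a | a : G].
Proof.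
apply/group_setP; split=> [|_ _ /imsetP[u _ ->] /imsetP[v _ ->]].
  apply/imsetP; exists 0 => //; apply/permP=> x; by rewrite lpE perm1 lam0.
by rewrite lpM; apply: imset_f.
Qed.

Let T := Group tr_group.
Let H := Group lp_group.

Let pT : (p.-group T)%g.
Proof.
rewrite /pgroup /= card_imset ?cardG ?pnatX ?pnat_id // => u v /permP/(_ 0).
by rewrite !trE !add0r.
Qed.

Let pH : (p.-group H)%g.
Proof.
apply/pnatP=> [|q q_pr /(Cauchy q_pr)[_ /imsetP[a _ ->] oq]]; first exact: cardG_gt0.
have [e le] := lam_unip a.
have le1 : (lp a ^+ (p ^ e) = 1)%g.
  by apply/permP=> x; rewrite permX perm1 -[RHS]le; apply: eq_iter => y; rewrite lpE.
have : (q %| p ^ e)%N by rewrite -oq order_dvdn le1.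
by rewrite Euclid_dvdX // dvdn_prime2 // => /andP[/eqP-> _]; rewrite inE.
Qed.

Let nTH : H \subset 'N(T)%g.
Proof.
apply/subsetP=> _ /imsetP[a _ ->]; rewrite inE; apply/subsetP=> _ /imsetP[_ /imsetP[v _ ->] ->].
apply/imsetP; exists (lam a v) => //; apply: (mulgI (lp a)).
rewrite -conjgC; apply/permP=> x.
by rewrite !permM !lpE !trE lamD.
Qed.

(** The translations and the maps [lam a] generate a $p$-group of
    permutations, which is nilpotent; the subgroups come from its lower central
    series, since the commutator of the translation by [v] with [lam a] is the
    translation by [lam a v - v]. *)
Lemma unipotent_flag : exists (U : nat -> G -> Prop) (r : nat),
  [/\ forall v, U 0 v, forall v, U r v -> v = 0,
      forall i, U i 0 /\ forall x y, U i x -> U i y -> U i (x - y),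
      forall i v, U i.+1 v -> U i v &
      forall i a v, U i v -> U i.+1 (lam a v - v)].
Proof.
pose Gam := (T <*> H)%G.
have pGam : (p.-group Gam)%g by rewrite /Gam /= (norm_joinEr nTH) pgroupM pT.
have sT v : tr v \in Gam by apply: (subsetP (joing_subl _ _)); apply: imset_f.
have sH a : lp a \in Gam by apply: (subsetP (joing_subr _ _)); apply: imset_f.
have /lcnP[r r1] := pgroup_nil pGam.
exists (fun i v => tr v \in 'L_i.+1(Gam)%g), r; split=> [v|v|i|i v|i a v].
- by rewrite lcn1.
- by rewrite r1 inE => /eqP/permP/(_ 0); rewrite trE perm1 add0r.
- split=> [|x y Ux Uy]; last by rewrite -trM -trV groupM ?groupV.
  rewrite (_ : tr 0 = 1%g) ?group1 //; apply/permP=> x; by rewrite trE perm1 addr0.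
- by apply: (subsetP (lcn_subS _ _)).
- move=> Uv; rewrite lcnSn (_ : tr _ = [~ tr v, lp a]%g) ?mem_commg //.
  rewrite commgEl trV; apply: (mulgI (tr v)); rewrite trM.
  rewrite mulgA trM subrr (_ : tr 0 = 1%g); last first.
    by apply/permP=> x; rewrite trE perm1 addr0.
  rewrite mul1g; apply: (mulgI (lp a)); rewrite -conjgC.
  by apply/permP=> x; rewrite !permM !lpE !trE lamD [v + _]addrC subrK.
Qed.

End Flag.

(** * The circle powers of an element and the ideals of the brace *)

(** The standing hypotheses on the brace. If $m = 0$, Property $1'$ makes the
    group divisible by [p], hence trivial. *)
Record admissible (p n : nat) (G : finZmodType) (circ : G -> G -> G) : Prop :=
  Admissible {
    adm_prime : prime p;
    adm_card : #|G| = (p ^ n)%N;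
    adm_brace : is_brace circ;
    adm_m_gt0 : (0 < p.-1 %/ 4)%N;
    adm_1' : property1' p circ;
    adm_1'' : property1'' p circ }.

(** The action of the circle group by additive automorphisms. *)
Definition lam (G : zmodType) (circ : G -> G -> G) (a v : G) : G := v + star circ a v.

Lemma exp_card (p n : nat) (G : finZmodType) (x : G) :
  #|G| = (p ^ n)%N -> x *+ p ^ n = 0.
Proof.
move=> <-; rewrite -FinRing.zmodXgE -cardsT; apply: (@expg_cardG G [group of [set: G]]).
by rewrite inE.
Qed.

Section Brace.
Variables (p n : nat) (G : finZmodType) (circ : G -> G -> G).
Hypothesis adm : admissible p n circ.
Let p_prime := adm_prime adm.
Let m := (p.-1 %/ 4)%N.
Notation L := (star circ).
Notation lam := (lam circ).
Implicit Types a b c v x y : G.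

Lemma order_killed x : x *+ p ^ n = 0.
Proof. exact: exp_card (adm_card adm). Qed.

Lemma circE a b : circ a b = a + lam a b.
Proof. by rewrite /lam /star [b + _]addrC subrK addrC subrK. Qed.

Lemma circ0r a : circ a 0 = a.
Proof.
have := brace_compat (adm_brace adm) a 0 0.
by rewrite addr0 => /addrI/esym.
Qed.

Lemma starD a : addf (L a).
Proof.
move=> b c; have /(canRL (addrK _)) := brace_compat (adm_brace adm) a b c.
by rewrite /star => ->; rewrite [RHS]addrACA -opprD (addrACA (circ a b)) !addrA.
Qed.

Local Opaque star.

Lemma lamD a : addf (lam a).
Proof. by move=> u v; rewrite /lam starD addrACA. Qed.

Lemma circA : associative circ. Proof. by case: (brace_group (adm_brace adm)). Qed.

Lemma circ0l a : circ 0 a = a.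
Proof.
have [_ [e [el er _]]] := brace_group (adm_brace adm).
by have <- : e = 0 by rewrite -(circ0r e) el.
Qed.

Lemma circV a : exists b, circ b a = 0 /\ circ a b = 0.
Proof.
have [_ [e [el er eV]]] := brace_group (adm_brace adm).
by have e0 : e = 0; [rewrite -(circ0r e) el|move: (eV a); rewrite e0].
Qed.

Lemma lam_circ a b v : lam (circ a b) v = lam a (lam b v).
Proof.
apply: (addrI (circ a b)); rewrite -circE -circA [circ b v]circE.
by rewrite circE lamD addrA -circE.
Qed.

Lemma lam0 v : lam 0 v = v.
Proof. by rewrite -[RHS]circ0l circE add0r. Qed.

Lemma star0l v : L 0 v = 0.
Proof. by apply: (addrI v); rewrite addr0 -[RHS]lam0. Qed.

Lemma star_circ a b v : L (circ a b) v = L a v + L b v + L a (L b v).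
Proof.
apply: (addrI v); rewrite -[LHS]/(lam _ _) lam_circ /lam starD.
rewrite -(addrA v (L b v)); congr (v + _).
by rewrite (addrA (L b v)) (addrC (L b v)).
Qed.

Lemma lamV a : exists b, forall v, lam a (lam b v) = v /\ lam b (lam a v) = v.
Proof.
have [b [ba ab]] := circV a; exists b => v.
by rewrite -!lam_circ ab ba lam0.
Qed.

Lemma lam_inj a : injective (lam a).
Proof. by have [b H] := lamV a => u v e; rewrite -(H u).2 e (H v).2. Qed.

(** A sum is turned into a circle product by $z = \lambda_a^{-1}(y)$, which
    inherits divisibility and order from [y]. *)
Lemma circ_solve a y : exists z,
  [/\ circ a z = a + y, y = z + L a z,
      forall N, divisible N y -> divisible N z &
      forall N, y *+ N = 0 -> z *+ N = 0].
Proof.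
have [b bP] := lamV a; exists (lam b y); split=> [| |N|N y0].
- by rewrite circE (bP y).1.
- by rewrite -[RHS]/(lam _ _) (bP y).1.
- by move=> dN; apply: (addf_divisible (lamD b)).
- by rewrite -addfMn ?y0 ?addf0 //; apply: lamD.
Qed.

Lemma Fil_star_m a : Fil p 1 (iter m (L a)).
Proof.
split=> [|x|i c c0]; first exact: addf_iter (starD a).
  by rewrite expn1; case: (adm_1' adm).
apply/eqP; apply: (adm_1'' adm a (isT : 0 < i.+1)%N).
by rewrite inE -addn1 c0.
Qed.

Lemma Fil_iter_star a i j : (m * j <= i)%N -> Fil p j (iter i (L a)).
Proof. exact: Fil_iter (starD a) (Fil_star_m a). Qed.

Lemma Fil_n0 f v : Fil p n f -> f v = 0.
Proof. by case=> _ /(_ v)[y ->] _; rewrite order_killed. Qed.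

Lemma iter_star0 a i v : (m * n <= i)%N -> iter i (L a) v = 0.
Proof. by move=> /(Fil_iter_star a)/Fil_n0. Qed.

(** The factor $p^{v_p(i)}$ that the binomial coefficient lacks is supplied by
    the power of $L_a$. *)
Lemma Fil_bin_iter a j i : (0 < i)%N ->
  Fil p j (fun v => iter i (L a) v *+ 'C(p ^ j, i)).
Proof.
move=> i0; have /dvdnP[q ->] := dvdn_bin_exp p_prime j i0.
have [vj|jv] := leqP (logn p i) j.
  rewrite -{1}(subnK vj).
  have F := Fil_iter_star a (leq_logn_div p_prime i0).
  by apply: Fil_ext (FilMn q (Fil_pMn (j - logn p i) F)) => v; rewrite mulnC mulrnA.
apply/FilMn/(Fil_iter_star a); apply: leq_trans (leq_logn_div p_prime i0).
by rewrite leq_mul2l ltnW ?orbT.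
Qed.

Lemma lam_iter a s v : iter s (lam a) v = \sum_(i < s.+1) iter i (L a) v *+ 'C(s, i).
Proof. exact: iter_add_binomial (starD a). Qed.

(** The maps $\lambda_a$ have $p$-power order because $L_a$ is nilpotent. *)
Lemma lam_unip a : exists e, forall v, iter (p ^ e) (lam a) v = v.
Proof.
exists (m * n + n)%N => v; rewrite lam_iter big_ord_recl bin0 big1 ?addr0 // => i _.
rewrite lift0; have [l|l] := leqP (m * n) i.+1; first by rewrite iter_star0 // mul0rn.
have F := Fil_bin_iter a (m * n + n) (ltn0Sn i).
have [_ /(_ v)[y ->] _] := F.
by rewrite expnD mulnC mulrnA order_killed mul0rn.
Qed.

Lemma star_flag : exists (U : nat -> G -> Prop) (r : nat),
  [/\ forall v, U 0 v, forall v, U r v -> v = 0,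
      forall i, U i 0 /\ forall x y, U i x -> U i y -> U i (x - y),
      forall i v, U i.+1 v -> U i v &
      forall i a v, U i v -> U i.+1 (L a v)].
Proof.
have [U [r [U0 Ur Us Ud Ul]]] := unipotent_flag p_prime (adm_card adm) lamD lam0 lam_circ lam_inj lam_unip.
exists U, r; split=> // i a v /(Ul _ a); rewrite /lam addrC addKr //.
Qed.

Definition circ_pow a s : G := iter s (circ a) 0.

Lemma circ_powE a s : circ_pow a s = \sum_(i < s) iter i (L a) a *+ 'C(s, i.+1).
Proof.
rewrite /circ_pow; elim: s => [|s IH]; first by rewrite big_ord0.
rewrite iterS IH circE /lam addf_sum //; last exact: starD.
under [RHS]eq_bigr => i _ do rewrite binS mulrnDr.
rewrite [RHS]big_split /= [X in _ = _ + X]big_ord_recl /= bin0 [RHS]addrCA.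
rewrite [in RHS]big_ord_recr /= (bin_small (ltnSn s)) mulr0n addr0.
congr (_ + (_ + _)); apply: eq_bigr => i _.
by rewrite addfMn //; apply: starD.
Qed.

Lemma lam_circ_pow a s v : lam (circ_pow a s) v = iter s (lam a) v.
Proof.
by rewrite /circ_pow; elim: s => [|s IH]; rewrite ?lam0 // iterS lam_circ IH.
Qed.

Lemma star_circ_pow a s v :
  L (circ_pow a s) v = \sum_(i < s) iter i.+1 (L a) v *+ 'C(s, i.+1).
Proof.
apply: (addrI v); rewrite -[LHS]/(lam _ _) lam_circ_pow lam_iter.
by rewrite big_ord_recl bin0.
Qed.

Lemma Fil_star_circ_pow a j : Fil p j (L (circ_pow a (p ^ j))).
Proof.
apply: Fil_ext (fun v => esym (star_circ_pow a (p ^ j) v)) _.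
apply: Fil_sum => i _; exact: Fil_bin_iter.
Qed.

Lemma Fil_star_circ j a b :
  Fil p j (L a) -> Fil p j (L b) -> Fil p j (L (circ a b)).
Proof.
move=> Fa Fb; apply: Fil_ext (fun v => esym (star_circ a b v)) _.
apply: FilD (FilD Fa Fb) _; apply: Fil_le (Fil_comp Fa Fb); exact: leq_addr.
Qed.

Section StarMultiples.
Variables j r : nat.
Hypothesis j_gt0 : (0 < j)%N.
Hypothesis Fil_deeper : forall x, divisible (p ^ r.+1) x -> Fil p j (L x).

Let Fil_star_add_deeper b c :
  Fil p j (L b) -> divisible (p ^ r.+1) c -> Fil p j (L (b + c)).
Proof.
move=> Fb dc; have [z [<- _ dz _]] := circ_solve b c.
by apply: Fil_star_circ => //; apply: Fil_deeper; apply: dz.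
Qed.

Let Fil_star_add a b : Fil p j (L a) -> Fil p j (L b) -> divisible (p ^ r) b ->
  Fil p j (L (a + b)).
Proof.
move=> Fa Fb db; have [z [<- /(canLR (addrK _)) zE dz _]] := circ_solve a b.
apply: Fil_star_circ => //; rewrite -zE; apply: Fil_star_add_deeper => //.
apply/divisibleN; apply: (@divisible_dvd _ _ (p ^ (r + j))).
  by rewrite dvdn_exp2l // -addn1 leq_add2l.
exact: Fil_divisible Fa (dz _ db).
Qed.

(** The elements that act at level [j] are closed under the circle product, and,
    given the claim for $p^{r+1} G$, under addition within $p^r G$. The power $y^{\circ p^j}$ is one of them and differs from $p^j y$ by
    an element of $p^{r+1} G$ and by $p^j$ times an element further down the
    flag, so a descending induction along the flag applies. *)
Lemma Fil_star_step x : (j <= r)%N -> divisible (p ^ r) x -> Fil p j (L x).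
Proof.
move=> jr dx.
have [U [s [U0 Us Usub Udec UL]]] := star_flag.
have Uadd i u v : U i u -> U i v -> U i (u + v).
  have [u0 ub] := Usub i => Uu Uv; rewrite -[v]opprK; apply: (ub) => //.
  by rewrite -[- v]add0r; apply: ub.
have UMn i u d : U i u -> U i (u *+ d).
  move=> Uu; elim: d => [|d IH]; first by case: (Usub i).
  by rewrite mulrS; apply: Uadd.
have Uopp i u : U i u -> U i (- u).
  by have [u0 ub] := Usub i => Uu; rewrite -[- u]add0r; apply: ub.
suff H i y : U i y -> divisible (p ^ (r - j)) y -> Fil p j (L (y *+ p ^ j)).
  have [y ->] := dx; rewrite -(subnK jr) expnD mulrnA.
  by apply: (H 0%N) => //; exists y.
have [d le_d] := ubnP (s - i); elim: d => // d IH in i y le_d *.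
have [si|lt_is] := leqP s i.
  move=> Uy _; have -> : y = 0.
    apply: Us; rewrite -(subnKC si) in Uy; elim: (i - s)%N Uy => [|e IHe]; first by rewrite addn0.
    by rewrite addnS => /Udec.
  rewrite mul0rn; apply: Fil_ext (fun v => esym (star0l v)) _; exact: Fil_zero.
move=> Uy dy.
pose F l := iter l (L y) y *+ 'C(p ^ j, l.+1).
have FE : circ_pow y (p ^ j) =
  y *+ p ^ j + (\sum_(1 <= l < p ^ j | coprime p l.+1) F l
              + \sum_(1 <= l < p ^ j | ~~ coprime p l.+1) F l).
  rewrite circ_powE -(big_mkord xpredT F) big_ltn ?expn_gt0 ?prime_gt0 //.
  by rewrite [\sum_(1 <= _ < _) _](bigID (fun l => coprime p l.+1)) /F bin1.
(* the powers [p^j] of the circle group are known; the terms whose index is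
   prime to [p] are [p^j]-multiples from a smaller member of the flag, and the
   others are divisible by one more power of [p] *)
have [z Uz [dz zE]] : exists2 z, U i.+1 z &
    divisible (p ^ (r - j)) z /\
    \sum_(1 <= l < p ^ j | coprime p l.+1) F l = z *+ p ^ j.
  rewrite big_mkcond big_seq_cond -big_mkcondr.
  elim/big_ind: _ => [|_ _ [u Uu [du ->]] [v Uv [dv ->]]|l].
  - by exists 0; [case: (Usub i.+1)|split; [exact: divisible0|rewrite mul0rn]].
  - by exists (u + v); [exact: Uadd|split; [exact: divisibleD|rewrite mulrnDl]].
  rewrite mem_index_iota andbT => /andP[/andP[l0 _] cl].
  have /dvdnP[q qE] := dvdn_bin_exp p_prime j (ltn0Sn l).
  have v0 : logn p l.+1 = 0%N by apply: logn_coprime.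
  exists (iter l (L y) y *+ q); last split.
  - apply: UMn; case: l l0 {cl qE v0} => // l _.
    elim: l => [|l IHl]; first exact: UL.
    by rewrite iterS; apply/Udec/UL.
  - apply/divisibleMn; apply: addf_divisible dy; exact: addf_iter (starD y).
  - by rewrite /F qE v0 subn0 mulrnA.
have dE : divisible (p ^ r.+1) (\sum_(1 <= l < p ^ j | ~~ coprime p l.+1) F l).
  rewrite big_mkcond big_seq_cond -big_mkcondr; apply: divisible_sum => l.
  rewrite prime_coprime // negbK => /andP[_ pl].
  have lE := leq_logn_quarter p_prime (ltn0Sn l) pl.
  have /dvdnP[q qE] := dvdn_bin_exp p_prime j (ltn0Sn l).
  have := Fil_divisible (Fil_iter_star y lE) dy.
  rewrite /F qE [(q * _)%N]mulnC mulrnA => D; apply/divisibleMn.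
  apply: divisible_dvd (divisible_mul (p ^ (j - logn p l.+1)) D).
  by rewrite -expnD dvdn_exp2l //; lia.
have -> : y *+ p ^ j = circ_pow y (p ^ j) + (- z) *+ p ^ j
   + - \sum_(1 <= l < p ^ j | ~~ coprime p l.+1) F l.
  by rewrite FE zE mulNrn -[RHS]addrA -opprD addrK.
apply: Fil_star_add_deeper; last exact: divisibleN.
apply: Fil_star_add; first exact: Fil_star_circ_pow.
  apply: (IH i.+1); [lia|exact: Uopp|exact: divisibleN].
by rewrite -(subnK jr) expnD; apply/divisible_mul/divisibleN.
Qed.

End StarMultiples.

(** A descending induction on [r], from $p^n G = 0$; the case of interest is
    [r = j]. *)
Lemma Fil_star r j x : (j <= r)%N -> divisible (p ^ r) x -> Fil p j (L x).
Proof.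
case: j => [_ _|j]; first exact: Fil0 (starD x).
have [d le_d] := ubnP (n - r); elim: d => // d IH in r x le_d *.
have [nr|rn] := leqP n r => jr.
  move=> /(divisible_dvd (dvdn_exp2l p nr))[y ->]; rewrite order_killed.
  apply: Fil_ext (fun v => esym (star0l v)) _; exact: Fil_zero.
apply: (Fil_star_step (r := r)) => // y; apply: IH; lia.
Qed.

(** If $p^i c = 0$ then all terms of the expansion of $c^{\circ p^i}$ vanish, so
    $\lambda_c^{p^i} = 1$; the expansion of this equation is $p^i L_c$ times a
    unipotent operator. *)
Lemma star_ann i c v : c *+ p ^ i = 0 -> L c v *+ p ^ i = 0.
Proof.
move=> c0.
have pow0 : circ_pow c (p ^ i) = 0.
  rewrite circ_powE big1 // => [[l /= _] _].
  case: l => [|l]; first by rewrite bin1.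
  have /dvdnP[q ->] := dvdn_bin_exp p_prime i (ltn0Sn l.+1).
  rewrite mulnC mulrnA; suff -> : iter l.+1 (L c) c *+ p ^ (i - logn p l.+2) = 0 by rewrite mul0rn.
  have le_v : (m * logn p l.+2 <= l.+1)%N.
    have [pl|pl] := boolP (p %| l.+2)%N.
      by have := leq_logn_quarter p_prime (ltn0Sn _) pl; rewrite mulnS /m; lia.
    by rewrite (_ : logn p l.+2 = 0)%N ?muln0 //; apply/eqP; rewrite -leqn0 leqNgt logn_gt0 mem_primes p_prime.
  have [_ _ Fa] := Fil_iter_star c le_v.
  apply: Fa; rewrite (_ : i - _ + _ = i + (logn p l.+2 - i))%N; last by lia.
  by rewrite expnD mulrnA c0 mul0rn.
suff H e : forall w, L c w *+ p ^ (i + e) = 0 by rewrite -(addn0 i) H.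
have [d le_d] := ubnP (n - e); elim: d => // d IH in e le_d *.
have [ne|en] := leqP n e => w.
  by rewrite -(subnKC ne) addnCA expnD mulrnA order_killed mul0rn.
have {}IH u : L c u *+ p ^ (i + e.+1) = 0 by apply: IH; lia.
(* the terms whose index is divisible by [p] vanish by induction *)
have step l u : iter l.+1 (L c) u *+ 'C(p ^ i, l.+1) *+ p ^ e = 0 \/
    exists q, iter l.+1 (L c) u *+ 'C(p ^ i, l.+1) *+ p ^ e
      = iter l (L c) (L c u *+ p ^ (i + e)) *+ q.
  have /dvdnP[q ->] := dvdn_bin_exp p_prime i (ltn0Sn l).
  have [pl|pl] := boolP (p %| l.+1)%N.
    left; rewrite iterSr.
    have [_ _ /= Fa] := Fil_iter_star c (leq_logn_quarter p_prime (ltn0Sn _) pl).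
    rewrite [(q * _)%N]mulnC mulrnA mulrnAC -(mulrnA _ (p ^ _)) -expnD mulrnAC Fa ?mul0rn //.
    rewrite (_ : i - _ + e + _ = i + e.+1 + (logn p l.+1 - i))%N; last by lia.
    by rewrite expnD mulrnA IH mul0rn.
  right; exists q; rewrite (_ : logn p l.+1 = 0)%N; last first.
    by apply: logn_coprime; rewrite prime_coprime.
  rewrite subn0 iterSr addfMn; last exact: addf_iter (starD c).
  by rewrite expnD -!mulrnA -mulnA [(q * _)%N]mulnC.
(* so [L c w *+ p ^ (i + e)] goes down the flag *)
have [U [r [U0 Ur Us Udec UL]]] := star_flag.
have Uopp s x : U s x -> U s (- x).
  by have [u0 ub] := Us s => Ux; rewrite -[- x]add0r; apply: ub.
have Uadd s x y : U s x -> U s y -> U s (x + y).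
  by have [u0 ub] := Us s => Ux Uy; rewrite -[y]opprK; apply: ub => //; apply: Uopp.
apply: Ur; elim: r => // r Ur.
have E0 : \sum_(0 <= l < p ^ i) iter l.+1 (L c) w *+ 'C(p ^ i, l.+1) *+ p ^ e = 0.
  by rewrite big_mkord sumrMnl -star_circ_pow pow0 star0l mul0rn.
rewrite big_ltn ?expn_gt0 ?prime_gt0 // bin1 /= -mulrnA -expnD in E0.
rewrite -[L c w *+ _]opprK (addr0_eq E0); apply: Uopp.
rewrite big_seq; elim/big_ind: _ => [|x y|l].
- by case: (Us r.+1).
- exact: Uadd.
rewrite mem_index_iota => /andP[l0 _].
have UX : U r.+1 (iter l (L c) (L c w *+ p ^ (i + e))).
  case: l l0 => // l _; elim: l => [|l IHl]; first exact: UL.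
  by rewrite iterS; apply/Udec/UL.
have [->|[q ->]] := step l w; first by case: (Us r.+1).
elim: q => [|q IHq]; first by case: (Us r.+1).
by rewrite mulrS; apply: Uadd.
Qed.

End Brace.

(** * Averaging over the roots of unity *)

Section Roots.
Variables (p n : nat) (gamma : int).
Hypothesis p_prime : prime p.
Hypothesis p_gt2 : (2 < p)%N.
Hypothesis gamma_prim : primitive_root_mod (p ^ n) gamma.
Let xi : int := gamma ^+ (p ^ n.-1).

Let Fp_dvd z : (p %| z)%Z -> z%:~R = 0 :> 'F_p.
Proof.
by case/dvdzP=> q ->; rewrite intrM -[X in _ * X]pmulrn pchar_Fp_0 // mulr0.
Qed.

Let Fp_exp (x : 'F_p) d : x ^+ (p ^ d) = x.
Proof.
have xp : x ^+ p = x by have := expf_card x; rewrite card_Fp.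
by elim: d => // d IH; rewrite expnS exprM xp.
Qed.

(** Modulo [p], $\xi$ is $\gamma$ by Fermat, and $\gamma$ generates the units; if
    $\xi^e = 1$ modulo [p], all $p - 1$ units would be roots of $X^{e'} - 1$,
    where $e' < p - 1$ is the remainder of [e] modulo $p - 1$. *)
Lemma primitive_root_order e : (0 < n)%N -> ~~ (p.-1 %| e)%N ->
  coprimez (xi ^+ e - 1) (p ^ n)%N.
Proof.
move=> n0 ndv; rewrite /coprimez /= /gcdz /= -[_ == _]/(coprime _ _) coprime_sym.
rewrite coprimeXl // prime_coprime //; apply/negP=> dv.
have xi1 : (gamma%:~R : 'F_p) ^+ e = 1.
  have := Fp_dvd (_ : (p %| xi ^+ e - 1)%Z); rewrite dvdzE /= => /(_ dv).
  by rewrite /xi rmorphB rmorphXn rmorphXn /= Fp_exp => /eqP; rewrite subr_eq0 => /eqP.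
have surj (b : 'F_p) : b != 0 -> exists j, b = gamma%:~R ^+ j.
  move=> b0; have [_ /(_ (val b)%:Z)] := gamma_prim.
  have cb : coprimez (val b)%:Z (p ^ n)%N.
    rewrite /coprimez /gcdz /= -[_ == _]/(coprime _ _) coprime_sym coprimeXl // prime_coprime //.
    have lt_b : (val b < p)%N by rewrite -[X in (_ < X)%N](Fp_cast p_prime) ltn_ord.
    rewrite gtnNdvd // lt0n; apply: contraNN b0 => /eqP bz; apply/eqP/val_inj.
    exact: bz.
  case/(_ cb)=> j /eqP; rewrite eqz_mod_dvd => dj; exists j.
  have /Fp_dvd : (p %| (val b)%:Z - gamma ^+ j)%Z.
    by apply: dvdz_trans dj; rewrite dvdzE /= -(prednK n0) expnS dvdn_mulr.
  rewrite rmorphB rmorphXn /= => /eqP; rewrite subr_eq0 -pmulrn => /eqP <-.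
  by rewrite natr_Zp.
pose e' := (e %% p.-1)%N.
have p1 : (0 < p.-1)%N by rewrite -ltnS prednK // ltnW // ltnW.
have e'_gt0 : (0 < e')%N by rewrite lt0n.
have e'_lt : (e' < p.-1)%N by rewrite ltn_mod.
have unit1 (b : 'F_p) : b != 0 -> b ^+ p.-1 = 1.
  move=> b0; apply: (mulfI b0); rewrite mulr1 -exprS prednK; last exact: prime_gt0.
  by rewrite -{2}[b](Fp_exp b 1) expn1.
have roots (b : 'F_p) : b != 0 -> e'.-unity_root b.
  move=> b0; have [j bE] := surj b b0; rewrite unity_rootE; apply/eqP.
  have be : b ^+ e = 1 by rewrite bE exprAC xi1 expr1n.
  by rewrite -be [in RHS](divn_eq e p.-1) exprD mulnC exprM unit1 // expr1n mul1r.
have all_roots : all e'.-unity_root (enum (predC1 (0 : 'F_p))).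
  by apply/allP=> b; rewrite mem_enum; apply: roots.
have := max_unity_roots e'_gt0 all_roots (enum_uniq _).
by rewrite -cardE cardC1 card_Fp // leqNgt e'_lt.
Qed.

Lemma primitive_root_exp : (xi ^+ p.-1 = 1 %[mod (p ^ n)%N])%Z.
Proof.
have [-> |n0] := posnP n; first by rewrite expn0 !modz1.
have [cop _] := gamma_prim.
rewrite /xi -exprM; have -> : (p ^ n.-1 * p.-1 = totient (p ^ n))%N.
  by rewrite totient_pfactor // mulnC.
have gE : (gamma = `|(gamma %% (p ^ n)%N)%Z|%N %[mod (p ^ n)%N])%Z.
  by rewrite gez0_abs ?modz_mod // modz_ge0 // -lt0n expn_gt0 prime_gt0.
rewrite -modzXm gE modzXm; set g := `|_|%N.
have cg : coprime g (p ^ n).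
  have := cop; rewrite /coprimez -gcdz_modl; rewrite /gcdz /g.
  by rewrite -[_ == _]/(coprime _ _) /=.
rewrite -[g%:Z]natz -natrX natz -[1]/(1%N%:Z) !modz_nat.
by rewrite Euler_exp_totient.
Qed.

(** Natural numbers representing the powers of $\xi$. *)
Definition unity_rep i : nat := `|(xi ^+ i %% (p ^ n)%N)%Z|%N.

Lemma unity_repE i : (unity_rep i = xi ^+ i %[mod (p ^ n)%N])%Z.
Proof.
by rewrite /unity_rep gez0_abs ?modz_mod // modz_ge0 // -lt0n expn_gt0 prime_gt0.
Qed.

Lemma unity_repXE i a : (i <= p.-1)%N ->
  (((unity_rep i ^ a * unity_rep (p.-1 - i))%N)%:Z = xi ^+ (i * (a + p.-2)) %[mod (p ^ n)%N])%Z.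
Proof.
move=> le_i; have PX (u v : nat) : (u ^ v)%N%:Z = u%:Z ^+ v by rewrite -[LHS]natz natrX natz.
rewrite PoszM PX -modzMml -modzXm unity_repE modzXm modzMml -modzMmr unity_repE modzMmr -exprM -exprD.
have X1 : (xi ^+ (i * p.-1) = 1 %[mod (p ^ n)%N])%Z.
  by rewrite mulnC exprM -modzXm primitive_root_exp modzXm expr1n.
have E : (i * p.-1 + (i * a + (p.-1 - i)) = p.-1 + i * (a + p.-2))%N.
  by move: le_i p_gt2; case: (p) => [|[|q]] //=; nia.
rewrite -[X in (X %% _)%Z = _]mul1r -modzMml -X1 modzMml -exprD E exprD.
by rewrite -modzMml primitive_root_exp modzMml mul1r.
Qed.

Variable V : zmodType.
Hypothesis V0 : forall x : V, x *+ p ^ n = 0.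

Lemma mulrz_mod (x : V) (y z : int) :
  (y = z %[mod (p ^ n)%N])%Z -> x *~ y = x *~ z.
Proof.
move=> /eqP; rewrite eqz_mod_dvd => /dvdzP[q /(canRL (subrK _)) ->].
by rewrite mulrzDr mulrC mulrzA -pmulrn V0 mul0rz add0r.
Qed.

(** A geometric sum with ratio $\xi^{a + p - 2}$, which is $\xi^{a - 1}$ with a
    natural exponent; $\xi^{a-1} - 1$ is invertible modulo [p] unless $a = 1$. *)
Lemma unity_rep_sum (x : V) a : (a < p.-1)%N ->
  \sum_(i < p.-1) x *+ (unity_rep i ^ a * unity_rep (p.-1 - i)) =
    x *+ (if a == 1%N then p.-1 else 0).
Proof.
move=> lt_a; have [n0 | n_gt0] := posnP n.
  have x0 : x = 0 by rewrite -(V0 x) n0 expn0.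
  by rewrite x0 big1 => [|i _]; rewrite mul0rn.
pose e := (a + p.-2)%N.
under eq_bigr => i _ do rewrite pmulrn (mulrz_mod _ (unity_repXE a (ltnW (ltn_ord i)))) -/e mulnC exprM.
have X1 j : ((xi ^+ p.-1) ^+ j = 1 %[mod (p ^ n)%N])%Z.
  by rewrite -modzXm primitive_root_exp modzXm expr1n.
have [a1|a1] := eqVneq a 1%N.
  under eq_bigr => i _.
    rewrite /e a1 (_ : 1 + p.-2 = p.-1)%N; last by move: p_gt2; case: (p) => [|[|[]]].
    rewrite (mulrz_mod _ (X1 i)) mulr1z.
  over.
  by rewrite sumr_const card_ord.
rewrite -mulrz_sumr mulr0n -[RHS](mulr0z x); apply: mulrz_mod.
apply/eqP; rewrite eqz_mod_dvd subr0.
have ndv : ~~ (p.-1 %| e)%N.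
  apply/negP=> /dvdnP[q qE]; move: qE lt_a a1 p_gt2; rewrite /e.
  case: (p) => [|[|[|r]]] //= => qE lt_a /eqP a1 _.
  by case: q qE => [|[|q]] qE; [lia | lia | nia].
rewrite -(Gauss_dvdzr (m := (p ^ n)%N) (n := xi ^+ e - 1)).
  by rewrite -subrX1 -exprM mulnC exprM -eqz_mod_dvd; apply/eqP.
by rewrite coprimez_sym primitive_root_order.
Qed.
End Roots.

(** * Binomial coefficients as polynomials *)

Definition ffact_poly i : {poly int} := \prod_(j < i) ('X - j%:Z%:P).

(** Signed Stirling numbers of the first kind. *)
Definition stirling1 i c : int := (ffact_poly i)`_c.

Lemma ffact_stirling1 i t :
  ((t ^_ i)%N)%:Z = \sum_(c < i.+1) stirling1 i c * (t%:Z ^+ c).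
Proof.
have sz : size (ffact_poly i) = i.+1.
  by rewrite /ffact_poly -(big_map (fun j : 'I_i => j%:Z) xpredT (fun z => 'X - z%:P)) size_prod_XsubC size_map -[index_enum _]enumT size_enum_ord.
transitivity (ffact_poly i).[t%:Z]; last by rewrite horner_coef sz.
rewrite /ffact_poly horner_prod.
elim: i {sz} => [|i IH]; first by rewrite big_ord0.
rewrite big_ord_recr /= -IH ffactnSr PoszM hornerXsubC.
have [it|ti] := leqP i t; first by rewrite subzn.
by rewrite ffact_small // !mul0r.
Qed.

Lemma stirling1_0 i : stirling1 i.+1 0 = 0.
Proof.
by rewrite /stirling1 -horner_coef0 horner_prod big_ord_recl hornerXsubC subrr mul0r.
Qed.

Lemma stirling1_1 i : stirling1 i.+1 1 = (-1) ^+ i * (i`!)%:Z.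
Proof.
rewrite /stirling1 /ffact_poly big_ord_recl subr0 coefXM /= -horner_coef0 horner_prod.
elim: i => [|i IH]; first by rewrite big_ord0.
rewrite big_ord_recr /= IH hornerXsubC sub0r /bump /= add1n factS exprS PoszM.
by ring.
Qed.

Section Units.
Variables (p n : nat) (V : zmodType).
Hypothesis p_prime : prime p.
Hypothesis V0 : forall x : V, x *+ p ^ n = 0.

Definition invmod (q d : nat) := (d ^ (totient q).-1)%N.

Lemma mulrn_mod (x : V) a b : a = b %[mod p ^ n] -> x *+ a = x *+ b.
Proof.
move=> ab; rewrite (divn_eq a (p ^ n)%N) (divn_eq b (p ^ n)%N) ab !mulrnDr.
by rewrite !(mulnC _ (p ^ n)%N) !mulrnA V0 !mul0rn.
Qed.

Lemma invmodP (x : V) d : coprime d p -> x *+ (d * invmod (p ^ n)%N d) = x.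
Proof.
move=> cd; rewrite -expnS prednK; last by rewrite totient_gt0 expn_gt0 prime_gt0.
by apply: (@mulrn_mod x _ 1); apply: Euler_exp_totient; rewrite coprimeXr.
Qed.

Lemma mulrn_coprime_inj (x y : V) d : coprime d p -> x *+ d = y *+ d -> x = y.
Proof. by move=> cd e; rewrite -(invmodP x cd) -(invmodP y cd) !mulrnA e. Qed.

(** The falling factorial is divided by $j!$, which is invertible as [j < p].
    That the constant term vanishes keeps constants out of the families obtained
    by substitution. *)
Lemma binomial_poly j : (j < p)%N -> exists s : nat -> int,
  ((0 < j)%N -> s 0%N = 0) /\
  forall (x : V) t, x *+ 'C(t, j) = \sum_(c < j.+1) (x *~ s c) *+ t ^ c.
Proof.
move=> jp; have cj : coprime j`! p.
  rewrite coprime_sym prime_coprime //; apply/negP.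
  elim: j jp => [|j IH] jp; first by rewrite fact0 dvdn1 => /eqP p1; move: p_prime; rewrite p1.
  by rewrite factS Euclid_dvdM // => /orP[/(dvdn_leq (ltn0Sn _))|]; [rewrite leqNgt jp|apply/IH/ltnW].
exists (fun c => stirling1 j c * (invmod (p ^ n)%N j`!)%:Z); split=> [|x t].
  by case: j {jp cj} => // j _; rewrite stirling1_0 mul0r.
apply: (mulrn_coprime_inj cj).
rewrite -mulrnA bin_ffact [LHS]pmulrn ffact_stirling1 mulrz_sumr -sumrMnl.
apply: eq_bigr => c _; rewrite !mulrzA; set y := x *~ _.
rewrite -(natz t) -natrX natz -!pmulrn -[LHS](invmodP _ cj) -!mulrnA.
by congr (_ *+ _); ring.
Qed.

End Units.

(** * Analytic families *)

Section AnalyticFamilies.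
Variables (p k : nat) (G : zmodType).
Implicit Types (F : nat -> G -> G) (X : nat -> G).

(** Operators and elements that are polynomials in a natural number [t], with
    monomials $t^a$ for $a \ge b$ only; the coefficient of $t^a$ is divisible by
    $p^{ka}$ for operators and by $p^{k(a-1)}$ for elements, and always by
    $p^{kM}$. They replace convergent power series: a large depth [M] forces
    them to vanish. *)
Inductive analytic_op b M : (nat -> G -> G) -> Prop :=
| analytic_op_nil F of (forall t v, F t v = 0) : analytic_op b M F
| analytic_op_cons a f F F' of (b <= a)%N & Fil p (k * maxn a M) f & analytic_op b M F &
    (forall t v, F' t v = f v *+ t ^ a + F t v) : analytic_op b M F'.

Inductive analytic b M : (nat -> G) -> Prop :=
| analytic_nil X of (forall t, X t = 0) : analytic b M X
| analytic_cons a x X X' of (b <= a)%N & divisible (p ^ (k * maxn a.-1 M)) x &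
    analytic b M X & (forall t, X' t = x *+ t ^ a + X t) : analytic b M X'.

Lemma analytic_op_ext b M F F' : (forall t v, F t v = F' t v) ->
  analytic_op b M F -> analytic_op b M F'.
Proof.
move=> e H; case: H e => [F0 F00|a f F0 F1 ba Ff H F1E] e.
  by apply: analytic_op_nil => t v; rewrite -e.
by apply: (analytic_op_cons ba Ff H) => t v; rewrite -e.
Qed.

Lemma analytic_ext b M X X' : (forall t, X t = X' t) -> analytic b M X -> analytic b M X'.
Proof.
move=> e H; case: H e => [F0 F00|a f F0 F1 ba Ff H F1E] e.
  by apply: analytic_nil => t; rewrite -e.
by apply: (analytic_cons ba Ff H) => t; rewrite -e.
Qed.

Lemma analytic_op_mono b M a f : (b <= a)%N -> Fil p (k * maxn a M) f ->
  analytic_op b M (fun t v => f v *+ t ^ a).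
Proof.
move=> ba Ff; have H : analytic_op b M (fun _ _ => 0) by apply: analytic_op_nil.
by apply: (analytic_op_cons ba Ff H) => t v; rewrite addr0.
Qed.

Lemma analytic_mono b M a x : (b <= a)%N -> divisible (p ^ (k * maxn a.-1 M)) x ->
  analytic b M (fun t => x *+ t ^ a).
Proof.
move=> ba dx; have H : analytic b M (fun _ => 0) by apply: analytic_nil.
by apply: (analytic_cons ba dx H) => t; rewrite addr0.
Qed.

Lemma analytic_op_weak b b' M M' F : (b' <= b)%N -> (M' <= M)%N ->
  analytic_op b M F -> analytic_op b' M' F.
Proof.
move=> bb MM; elim=> [F0 F00|a f F0 F1 ba Ff _ IH F1E]; first exact: analytic_op_nil.
apply: (analytic_op_cons (leq_trans bb ba) _ IH F1E); apply: Fil_le Ff.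
by rewrite leq_mul2l; apply/orP; right; lia.
Qed.

Lemma analytic_weak b b' M M' X : (b' <= b)%N -> (M' <= M)%N ->
  analytic b M X -> analytic b' M' X.
Proof.
move=> bb MM; elim=> [X0 X00|a x X0 X1 ba dx _ IH X1E]; first exact: analytic_nil.
apply: (analytic_cons (leq_trans bb ba) _ IH X1E); apply: divisible_dvd dx.
by rewrite dvdn_exp2l // leq_mul2l; apply/orP; right; lia.
Qed.

Lemma analytic_opD b M F F' : analytic_op b M F -> analytic_op b M F' ->
  analytic_op b M (fun t v => F t v + F' t v).
Proof.
move=> H H'; elim: H => [F0 F00|a f F0 F1 ba Ff _ IH F1E].
  by apply: analytic_op_ext H' => t v; rewrite F00 add0r.
by apply: (analytic_op_cons ba Ff IH) => t v; rewrite F1E addrA.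
Qed.

Lemma analyticD b M X X' : analytic b M X -> analytic b M X' -> analytic b M (fun t => X t + X' t).
Proof.
move=> H H'; elim: H => [F0 F00|a f F0 F1 ba Ff _ IH F1E].
  by apply: analytic_ext H' => t; rewrite F00 add0r.
by apply: (analytic_cons ba Ff IH) => t; rewrite F1E addrA.
Qed.

Lemma analytic_opN b M F : analytic_op b M F -> analytic_op b M (fun t v => - F t v).
Proof.
elim=> [F0 F00|a f F0 F1 ba Ff _ IH F1E].
  by apply: analytic_op_nil => t v; rewrite F00 oppr0.
by apply: (analytic_op_cons ba (FilN Ff) IH) => t v; rewrite F1E opprD mulNrn.
Qed.

Lemma analyticN b M X : analytic b M X -> analytic b M (fun t => - X t).
Proof.
elim=> [F0 F00|a f F0 F1 ba Ff _ IH F1E].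
  by apply: analytic_nil => t; rewrite F00 oppr0.
by apply: (analytic_cons ba (divisibleN Ff) IH) => t; rewrite F1E opprD mulNrn.
Qed.

Lemma analytic_op_sum b M I (r : seq I) (P : pred I) (F : I -> nat -> G -> G) :
  (forall i, P i -> analytic_op b M (F i)) ->
  analytic_op b M (fun t v => \sum_(i <- r | P i) F i t v).
Proof.
move=> H; elim: r => [|i r IH]; first by apply: analytic_op_nil => t v; rewrite big_nil.
case Pi: (P i); last by apply: analytic_op_ext IH => t v; rewrite big_cons Pi.
by apply: analytic_op_ext (analytic_opD (H i Pi) IH) => t v; rewrite big_cons Pi.
Qed.

Lemma analytic_sum b M I (r : seq I) (P : pred I) (X : I -> nat -> G) :
  (forall i, P i -> analytic b M (X i)) -> analytic b M (fun t => \sum_(i <- r | P i) X i t).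
Proof.
move=> H; elim: r => [|i r IH]; first by apply: analytic_nil => t; rewrite big_nil.
case Pi: (P i); last by apply: analytic_ext IH => t; rewrite big_cons Pi.
by apply: analytic_ext (analyticD (H i Pi) IH) => t; rewrite big_cons Pi.
Qed.

Lemma analytic_op_Fil b M F t : analytic_op b M F -> Fil p (k * maxn b M) (F t).
Proof.
elim=> [F0 F00|a f F0 F1 ba Ff _ IH F1E].
  by apply: Fil_ext (Fil_zero _ _ _) => v; rewrite F00.
apply: Fil_ext (fun v => esym (F1E t v)) _; apply: FilD IH; apply: FilMn.
by apply: Fil_le Ff; rewrite leq_mul2l; apply/orP; right; lia.
Qed.

Lemma analytic_op_addf b M F t : analytic_op b M F -> addf (F t).
Proof. by move/(analytic_op_Fil t)/Fil_addf. Qed.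

Lemma analytic_divisible b M X t : analytic b M X -> divisible (p ^ (k * M)) (X t).
Proof.
elim=> [F0 F00|a f F0 F1 ba Ff _ IH F1E]; first by rewrite F00; apply: divisible0.
rewrite F1E; apply: divisibleD IH; apply: divisibleMn; apply: divisible_dvd Ff.
by rewrite dvdn_exp2l // leq_mul2l; apply/orP; right; lia.
Qed.

Let analytic_op_lmono b M a M' f F : Fil p (k * maxn a M') f -> analytic_op b M F ->
  analytic_op (a + b) (M' + M) (fun t v => f (F t v) *+ t ^ a).
Proof.
move=> Ff; have fD := Fil_addf Ff; elim=> [F0 F00|a0 f0 F0 F1 ba Ff0 _ IH F1E].
  by apply: analytic_op_nil => t v; rewrite F00 addf0 // mul0rn.
apply: (analytic_op_cons (a := a + a0) (f := fun v => f (f0 v))) IH _.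
- by rewrite leq_add2l.
- by apply: Fil_le (Fil_comp Ff Ff0); rewrite -mulnDr leq_mul2l; apply/orP; right; lia.
- by move=> t v; rewrite F1E fD addfMn // mulrnDl expnD [(t ^ a * _)%N]mulnC mulrnA.
Qed.

Lemma analytic_op_comp b b' M M' F F' : analytic_op b M F -> analytic_op b' M' F' ->
  analytic_op (b + b') (M + M') (fun t v => F t (F' t v)).
Proof.
move=> H H'; elim: H => [F0 F00|a f F0 F1 ba Ff _ IH F1E]; first exact: analytic_op_nil.
apply: analytic_op_ext (fun t v => esym (F1E t (F' t v))) _; apply: analytic_opD IH.
by apply: analytic_op_weak (analytic_op_lmono Ff H'); rewrite // leq_add2r.
Qed.

Let analytic_lmono b M a M' f X : Fil p (k * maxn a M') f -> analytic b M X ->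
  analytic (a + b) (M' + M) (fun t => f (X t) *+ t ^ a).
Proof.
move=> Ff; have fD := Fil_addf Ff; elim=> [X0 X00|a0 x0 X0 X1 ba dx _ IH X1E].
  by apply: analytic_nil => t; rewrite X00 addf0 // mul0rn.
apply: (analytic_cons (a := a + a0) (x := f x0)) IH _.
- by rewrite leq_add2l.
- apply: divisible_dvd (Fil_divisible Ff dx).
  by rewrite dvdn_exp2l // -mulnDr leq_mul2l; apply/orP; right; lia.
- by move=> t; rewrite X1E fD addfMn // mulrnDl expnD [(t ^ a * _)%N]mulnC mulrnA.
Qed.

Lemma analytic_op_app b b' M M' F X : analytic_op b M F -> analytic b' M' X ->
  analytic (b + b') (M + M') (fun t => F t (X t)).
Proof.
move=> H H'; elim: H => [F0 F00|a f F0 F1 ba Ff _ IH F1E]; first exact: analytic_nil.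
apply: analytic_ext (fun t => esym (F1E t (X t))) _; apply: analyticD IH.
by apply: analytic_weak (analytic_lmono Ff H'); rewrite // leq_add2r.
Qed.

Hypothesis V0 : forall x : G, x *+ p ^ (k * p.-1) = 0.

Lemma divisible_deep d (x : G) : (p.-1 <= d)%N -> divisible (p ^ (k * d)) x -> x = 0.
Proof.
move=> le_d [y ->]; rewrite -(subnKC le_d) mulnDr expnD mulrnA V0 mul0rn //.
Qed.

(** The Neumann series for $(1 + F)^{-1} = 1 + F'$, which stops because
    $F^{p-1} = 0$; the family [F2] collects its terms from $F^2$ on. *)
Lemma analytic_op_inverse b M F : (0 < b)%N -> analytic_op b M F -> exists F' F2,
  [/\ analytic_op b M F', analytic_op (b + b) M F2,
      forall t v, F' t v = - F t v + F2 t v &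
      forall t v, v + F' t v + F t (v + F' t v) = v].
Proof.
move=> b0 HF.
pose H := fix H N t v := if N is N'.+1 then - F t (v + H N' t v) else 0 : G.
have FD t := analytic_op_addf t HF.
have HH N : analytic_op b M (H N).
  elim: N => [|N IH]; first exact: analytic_op_nil.
  apply: (analytic_op_ext (F := fun t v => - F t v + - F t (H N t v))).
    by move=> t v /=; rewrite FD opprD.
  apply: analytic_opD; apply: analytic_opN => //.
  by apply: analytic_op_weak (analytic_op_comp HF IH); rewrite leq_addr.
have diff N t v : divisible (p ^ (k * N)) (H N.+1 t v - H N t v).
  elim: N => [|N IH]; first by rewrite muln0 expn0; exists (H 1%N t v - H 0%N t v).
  rewrite (_ : _ - _ = - F t (H N.+1 t v - H N t v)).
    apply: divisibleN; apply: divisible_dvd (Fil_divisible (analytic_op_Fil t HF) IH).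
    rewrite dvdn_exp2l // -mulnDr leq_mul2l; apply/orP; right.
    by have := leq_maxl b M; lia.
  rewrite -[LHS]/(- F t (v + H N.+1 t v) - - F t (v + H N t v)) -opprD -(addfB (FD t)).
  by congr (- F t _); rewrite opprD addrACA subrr add0r.
exists (H p.-1.+1), (fun t v => - F t (H p.-1 t v)); split=> [|| t v|t v].
- exact: HH.
- by apply: analytic_opN; apply: analytic_op_weak (analytic_op_comp HF (HH _)); rewrite // leq_addr.
- by rewrite /= FD opprD.
have e : H p.-1.+1 t v = H p.-1 t v.
  by apply/eqP; rewrite -subr_eq0; apply/eqP; apply: divisible_deep (diff p.-1 t v).
by rewrite [in F t _]e -addrA addNr addr0.
Qed.

End AnalyticFamilies.

(** * The linear part of the action *)

Section LinearPart.
Variables (p n k : nat) (G : finZmodType) (circ : G -> G -> G) (gamma : int).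
Hypothesis adm : admissible p n circ.
Hypothesis expk : forall x : G, x *+ p ^ (k * p.-1) = 0.
Hypothesis gamma_prim : primitive_root_mod (p ^ n) gamma.
Let p_prime := adm_prime adm.
Notation L := (star circ).
Implicit Types (x y v : G).
Local Opaque star.

Lemma p_gt2 : (2 < p)%N.
Proof. by have := adm_m_gt0 adm; rewrite divn_gt0 //; lia. Qed.

(** The action of $p^k x$. *)
Definition Phi x v := L (x *+ p ^ k) v.

Lemma PhiD x : addf (Phi x). Proof. exact: starD adm _. Qed.

Lemma Phi0 v : Phi 0 v = 0. Proof. by rewrite /Phi mul0rn (star0l adm). Qed.

Lemma Fil_Phi e x : divisible (p ^ (k * e)) x -> Fil p (k * e.+1) (Phi x).
Proof.
move=> dx; apply: (Fil_star adm (leqnn _)).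
by rewrite mulnS addnC expnD; apply: divisible_mul.
Qed.

(** The circle product of $p^k x$ and $p^k y$ is $p^k (x + y + \Phi_x(y))$. *)
Lemma Phi_add x y v : Phi (x + (y + Phi x y)) v = Phi x v + Phi y v + Phi x (Phi y v).
Proof.
rewrite /Phi -(star_circ adm) (circE circ); congr (L _ v).
by rewrite mulrnDl /lam mulrnDl -(addfMn (starD adm _)).
Qed.

Lemma analytic_op_binomial a M j g : (0 < j < p)%N -> (a <= M)%N -> Fil p (k * (j * M)) g ->
  analytic_op p k a M (fun t v => g v *+ 'C(t ^ a, j)).
Proof.
move=> /andP[j0 jp] aM Fg.
have [s [s0 sE]] := binomial_poly p_prime (order_killed adm) jp.
apply: (analytic_op_ext (F := fun t v => \sum_(c < j.+1) (g v *~ s c) *+ t ^ (a * c))).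
  by move=> t v; rewrite sE; apply: eq_bigr => c _; rewrite expnM.
apply: analytic_op_sum => -[[|c] lt_c] _ /=.
  by apply: analytic_op_nil => t v; rewrite s0 // mulr0z mul0rn.
apply: analytic_op_mono; first by rewrite leq_pmulr.
apply: FilMz; apply: Fil_le Fg; rewrite leq_mul2l; apply/orP; right.
by rewrite geq_max leq_pmull // andbT mulnC; apply: leq_mul.
Qed.

Lemma analytic_binomial a M j y : (0 < j < p)%N -> (0 < a)%N ->
  divisible (p ^ (k * maxn (a * j).-1 M)) y ->
  analytic p k a M (fun t => y *+ 'C(t ^ a, j)).
Proof.
move=> /andP[j0 jp] a0 dy.
have [s [s0 sE]] := binomial_poly p_prime (order_killed adm) jp.
apply: (analytic_ext (X := fun t => \sum_(c < j.+1) (y *~ s c) *+ t ^ (a * c))).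
  by move=> t; rewrite sE; apply: eq_bigr => c _; rewrite expnM.
apply: analytic_sum => -[[|c] lt_c] _ /=.
  by apply: analytic_nil => t; rewrite s0 // mulr0z mul0rn.
apply: analytic_mono; first by rewrite leq_pmulr.
have [z zE] : divisible (p ^ (k * maxn (a * c.+1).-1 M)) y.
  apply: divisible_dvd dy; rewrite dvdn_exp2l // leq_mul2l; apply/orP; right.
  have : (a * c.+1 <= a * j)%N by rewrite leq_mul2l; apply/orP; right.
  by lia.
by exists (z *~ s c.+1); rewrite zE !pmulrn mulrzAC.
Qed.

Lemma sum_bin_trunc N (F : nat -> G) s : (forall j, (N <= j)%N -> F j = 0) ->
  \sum_(j < s) F j *+ 'C(s, j.+1) = \sum_(j < N) F j *+ 'C(s, j.+1).
Proof.
move=> F0; rewrite -!(big_mkord xpredT (fun j => F j *+ 'C(s, j.+1))).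
have [sN|Ns] := leqP s N.
  rewrite [RHS](@big_cat_nat _ _ _ s) //= [X in _ + X]big_nat_cond [X in _ + X]big1 ?addr0 //.
  by move=> j /andP[/andP[sj _] _]; rewrite bin_small.
rewrite (@big_cat_nat _ _ _ N) //=; last exact: ltnW.
rewrite [X in _ + X]big_nat_cond [X in _ + X]big1 ?addr0 //.
by move=> j /andP[/andP[Nj _] _]; rewrite F0 // mul0rn.
Qed.

(** The circle powers of $p^k x$ and their action are binomial sums in the
    exponent, and only the first term of the sum has the depth of [x] itself. *)
Lemma Phi_power a e x : (0 < a <= e.+1)%N -> divisible (p ^ (k * e)) x ->
  exists X, analytic_op p k a e.+1 (fun t v => Phi (X t) v) /\
            analytic p k a e.+1 (fun t => x *+ t ^ a - X t).
Proof.
move=> /andP[a0 ae] dx.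
have Ff := Fil_Phi dx; have fD := PhiD x.
have Fj j : Fil p (k * (j * e.+1)) (iter j (Phi x)).
  by rewrite mulnCA; apply: Fil_iterM.
have p2 := p_gt2.
pose X t := \sum_(j < t ^ a) iter j (Phi x) x *+ 'C(t ^ a, j.+1).
have iterMn j : iter j (Phi x) (x *+ p ^ k) = iter j (Phi x) x *+ p ^ k.
  by rewrite addfMn //; apply: addf_iter.
have XE t : X t *+ p ^ k = circ_pow circ (x *+ p ^ k) (t ^ a).
  rewrite (circ_powE adm) /X -sumrMnl; apply: eq_bigr => j _.
  by rewrite mulrnAC -iterMn.
exists X; split.
  apply: (analytic_op_ext (F := fun t v => \sum_(j < p.-1) iter j.+1 (Phi x) v *+ 'C(t ^ a, j.+1))).
    move=> t v; rewrite [in RHS]/Phi XE (star_circ_pow adm) -[L _]/(Phi x).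
    symmetry; apply: (sum_bin_trunc (F := fun j => iter j.+1 (Phi x) v)) => j pj.
    have [_ /(_ v) d _] := Fj j.+1; apply: (divisible_deep expk) d.
    by rewrite -[p.-1]muln1; apply: leq_mul => //; apply: leq_trans pj _.
  apply: analytic_op_sum => j _; apply: analytic_op_binomial => //=.
  by have := ltn_ord j; lia.
have dj j : divisible (p ^ (k * (e + j * e.+1))) (iter j (Phi x) x).
  by rewrite mulnDr; apply: Fil_divisible (Fj j) dx.
apply: (analytic_ext (X := fun t => - \sum_(j < p.-2) iter j.+1 (Phi x) x *+ 'C(t ^ a, j.+2))).
  move=> t; rewrite /X (@sum_bin_trunc p.-1 (fun j => iter j (Phi x) x)); last first.
    move=> j pj; apply: (divisible_deep expk) (dj j).
    by rewrite mulnS; lia.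
  rewrite (_ : p.-1 = p.-2.+1)%N; last by lia.
  by rewrite big_ord_recl /= bin1 opprD addNKr.
apply: analyticN; apply: analytic_sum => j _; apply: analytic_binomial => //.
  by have := ltn_ord j; lia.
apply: divisible_dvd (dj j.+1); rewrite dvdn_exp2l // leq_mul2l; apply/orP; right.
have : (a * j.+2 <= e.+1 * j.+2)%N by rewrite leq_mul2r; apply/orP; right.
by rewrite geq_max => H; apply/andP; split; nia.
Qed.

(** Adding [w] is a circle product with $(1 + \Phi_Y)^{-1} w$. *)
Lemma Phi_solve F F' (Y : nat -> G) t w v : (forall v, F t v = Phi (Y t) v) ->
  (forall v, v + F' t v + F t (v + F' t v) = v) ->
  Phi (Y t + w) v = Phi (Y t) v + Phi (w + F' t w) v + Phi (Y t) (Phi (w + F' t w) v).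
Proof. by move=> FE FF; rewrite -Phi_add -FE FF. Qed.

(** Since the action is a homomorphism and not additive, the monomials of the
    family are peeled off one at a time: $t^a x$ is replaced by a power of [x],
    whose action is known, at the price of terms of higher depth. *)
Lemma analytic_op_Phi b X : (0 < b)%N -> analytic p k b 0 X ->
  analytic_op p k b 0 (fun t v => Phi (X t) v).
Proof.
suff H M : forall X, (0 < b)%N -> analytic p k b M X ->
  analytic_op p k b 0 (fun t v => Phi (X t) v) by apply: H.
have [d le_d] := ubnP (p.-1 - M); elim: d => // d IHd in M le_d *.
move=> {}X b0 HX; have [pM|Mp] := leqP p.-1 M.
  apply: analytic_op_nil => t v; rewrite (divisible_deep expk pM (analytic_divisible t HX)).
  exact: Phi0.
have {}IHd X' : analytic p k b M.+1 X' -> analytic_op p k b 0 (fun t v => Phi (X' t) v).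
  by apply: IHd => //; lia.
suff main Z : analytic p k b M.+1 Z -> analytic_op p k b 0 (fun t v => Phi (X t + Z t) v).
  apply: analytic_op_ext (main (fun _ => 0) (analytic_nil _ _ _ _ _)) => [t v|] //.
  by rewrite addr0.
elim: HX Z => [X0 X00|a x X0 X1 ba dx HX0 IH X1E] Z HZ.
  by apply: analytic_op_ext (IHd Z HZ) => t v; rewrite X00 add0r.
have a0 := leq_trans b0 ba.
have ae : (0 < a <= (maxn a.-1 M).+1)%N by rewrite a0 /=; lia.
have [Y [FY dY]] := Phi_power ae dx.
set F := fun t v => Phi (Y t) v in FY.
have {}FY : analytic_op p k b M.+1 F by apply: analytic_op_weak FY => //; rewrite ltnS leq_maxr.
have {}dY : analytic p k b M.+1 (fun t => x *+ t ^ a - Y t).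
  by apply: analytic_weak dY => //; rewrite ltnS leq_maxr.
have [F' [_ [HF' _ _ FF]]] := analytic_op_inverse expk b0 FY.
pose Z1 t := Z t + (x *+ t ^ a - Y t).
have HZ1 : analytic p k b M.+1 Z1 by apply: analyticD.
pose Z2 t := Z1 t + F' t (X0 t + Z1 t).
have HZ2 : analytic p k b M.+1 Z2.
  apply: analyticD => //; apply: analytic_weak (analytic_op_app HF' (analyticD HX0 (analytic_weak (leqnn b) (leqnSn M) HZ1))).
  - exact: leq_addr.
  - exact: leq_addr.
have HP := IH Z2 HZ2.
apply: (analytic_op_ext (F := fun t v => F t v + Phi (X0 t + Z2 t) v + F t (Phi (X0 t + Z2 t) v))).
  move=> t v; rewrite /Z2; transitivity (Phi (Y t + (X0 t + Z1 t)) v).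
    by rewrite (@Phi_solve F F' Y t _ v (fun=> erefl) (FF t)) (addrA (X0 t)).
  congr (Phi _ v); rewrite X1E /Z1 addrCA [Y t + _]addrCA subrKC.
  by rewrite -[RHS]addrA [RHS]addrCA [in RHS](addrC (x *+ _)).
apply: analytic_opD; first apply: analytic_opD => //.
  by apply: analytic_op_weak FY.
by apply: analytic_op_weak (analytic_op_comp FY HP); rewrite ?leq_addr.
Qed.

(** By [unity_rep_sum] this extracts $p - 1$ times the coefficient of [t] from a
    polynomial of degree at most $p - 2$. *)
Definition avg (X : nat -> G) : G :=
  \sum_(i < p.-1) X (unity_rep p n gamma i) *+ unity_rep p n gamma (p.-1 - i).

Lemma avg_ext X X' : (forall t, X t = X' t) -> avg X = avg X'.
Proof. by move=> e; apply: eq_bigr => i _; rewrite e. Qed.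

Lemma avg0 X : (forall t, X t = 0) -> avg X = 0.
Proof. by move=> X0; rewrite /avg big1 // => i _; rewrite X0 mul0rn. Qed.

Lemma avgD X X' : avg (fun t => X t + X' t) = avg X + avg X'.
Proof. by rewrite /avg -big_split; apply: eq_bigr => i _; rewrite mulrnDl. Qed.

Lemma avg_addf f X : addf f -> avg (fun t => f (X t)) = f (avg X).
Proof.
by move=> fD; rewrite /avg addf_sum //; apply: eq_bigr => i _; rewrite addfMn.
Qed.

Lemma avg_monomial x a : (a < p.-1)%N ->
  avg (fun t => x *+ t ^ a) = x *+ (if a == 1%N then p.-1 else 0).
Proof.
move=> lt_a; rewrite -(unity_rep_sum (adm_prime adm) p_gt2 gamma_prim (order_killed adm) x lt_a).
by apply: eq_bigr => i _; rewrite mulrnA.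
Qed.

Lemma avg_const x : avg (fun _ => x) = 0.
Proof.
have lt0 : (0 < p.-1)%N by have := p_gt2; lia.
by rewrite -[RHS](mulr0n x) -(avg_monomial x lt0); apply: avg_ext => t.
Qed.

Lemma avg_linear x : avg (fun t => x *+ t) = x *+ p.-1.
Proof.
have lt1 : (1 < p.-1)%N by have := p_gt2; lia.
by rewrite -(avg_monomial x lt1); apply: avg_ext => t; rewrite expn1.
Qed.

Lemma avg_analytic_op F v : analytic_op p k 2 0 F -> avg (fun t => F t v) = 0.
Proof.
elim=> [F0 F00|a f F0 F1 a2 Ff _ IH F1E].
  by apply: avg0.
rewrite (avg_ext (fun t => F1E t v)) avgD IH addr0.
have [lt_a|le_a] := ltnP a p.-1.
  by rewrite avg_monomial // (_ : a == 1%N = false) //; apply/eqP; lia.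
rewrite maxn0 in Ff; have [_ /(_ v)/(divisible_deep expk le_a) -> _] := Ff.
by apply: avg0 => t; rewrite mul0rn.
Qed.

(** Up to the factor [p - 1], this is the coefficient of [t] in the action of
    [p^k t x]. *)
Definition linear_part x v := avg (fun t => Phi (x *+ t) v).

Lemma analytic_linear x : analytic p k 1 0 (fun t => x *+ t).
Proof.
apply: (analytic_ext (X := fun t => x *+ t ^ 1)) => [t|]; first by rewrite expn1.
by apply: analytic_mono => //; rewrite muln0; exists x.
Qed.

Lemma analytic_op_Phi_linear x : analytic_op p k 1 0 (fun t v => Phi (x *+ t) v).
Proof. by apply: analytic_op_Phi => //; apply: analytic_linear. Qed.

Lemma Phi_split x X : analytic p k 2 0 X -> exists W,
  analytic p k 2 0 W /\ forall t v, Phi (x *+ t + X t) v =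
     Phi (x *+ t) v + Phi (W t) v + Phi (x *+ t) (Phi (W t) v).
Proof.
move=> HX; have HF := analytic_op_Phi_linear x.
have [F' [_ [HF' _ _ FF]]] := analytic_op_inverse expk (isT : 0 < 1)%N HF.
exists (fun t => X t + F' t (X t)); split.
  by apply: analyticD => //; apply: analytic_weak (analytic_op_app HF' HX).
move=> t v; exact: (Phi_solve (F := fun t v => Phi (x *+ t) v) (Y := fun t => x *+ t) _ _ (fun=> erefl) (FF t)).
Qed.

(** The rest of the family acts by a family of order 2 by [analytic_op_Phi], which
    the average kills. *)
Lemma avg_Phi x X v : analytic p k 2 0 X ->
  avg (fun t => Phi (x *+ t + X t) v) = linear_part x v.
Proof.
move=> /(Phi_split x)[W [HW E]].
have HP := analytic_op_Phi (isT : 0 < 2)%N HW.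
rewrite (avg_ext (fun t => E t v)) avgD avgD -/(linear_part x v).
have -> : avg (fun t => Phi (W t) v) = 0 by apply: avg_analytic_op HP.
have -> : avg (fun t => Phi (x *+ t) (Phi (W t) v)) = 0.
  apply: (@avg_analytic_op (fun t v => Phi (x *+ t) (Phi (W t) v))).
  by apply: analytic_op_weak (analytic_op_comp (analytic_op_Phi_linear x) HP).
by rewrite !addr0.
Qed.

Lemma linear_partDr x : addf (linear_part x).
Proof.
move=> u v; rewrite /linear_part -avgD; apply: avg_ext => t; exact: PhiD.
Qed.

(** The homomorphism property along $t x$ and $t (1 + \Phi_{tx})^{-1} y$; the
    second path has linear term [y], and the product of the two actions has no
    linear term. *)
Lemma linear_partDl x y v : linear_part (x + y) v = linear_part x v + linear_part y v.
Proof.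
have HF := analytic_op_Phi_linear x.
have [F' [_ [HF' _ _ FF]]] := analytic_op_inverse expk (isT : 0 < 1)%N HF.
have HY : analytic p k 2 0 (fun t => F' t (y *+ t)).
  by apply: analytic_weak (analytic_op_app HF' (analytic_linear y)).
have HP := analytic_op_Phi (isT : 0 < 1)%N (analyticD (analytic_linear y) (analytic_weak (leqnSn 1) (leqnn 0) HY)).
rewrite -(avg_Phi y v HY) {1}/linear_part.
rewrite (avg_ext (X' := fun t => Phi (x *+ t) v + Phi (y *+ t + F' t (y *+ t)) v
   + Phi (x *+ t) (Phi (y *+ t + F' t (y *+ t)) v))).
  rewrite avgD avgD.
  have -> : avg (fun t => Phi (x *+ t) (Phi (y *+ t + F' t (y *+ t)) v)) = 0.
    apply: (@avg_analytic_op (fun t v => Phi (x *+ t) (Phi (y *+ t + F' t (y *+ t)) v))).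
    by apply: analytic_op_weak (analytic_op_comp HF HP).
  by rewrite addr0.
move=> t; rewrite mulrnDl.
exact: (Phi_solve (F := fun t v => Phi (x *+ t) v) (Y := fun t => x *+ t) _ _ (fun=> erefl) (FF t)).
Qed.

Lemma linear_partE v : addf (fun x => linear_part x v).
Proof. by move=> x y; apply: linear_partDl. Qed.

Lemma linear_part0l v : linear_part 0 v = 0.
Proof. exact: (addf0 (linear_partE v)). Qed.

Lemma linear_partNl x v : linear_part (- x) v = - linear_part x v.
Proof. exact: (addfN (linear_partE v)). Qed.

Lemma linear_partMnl x d v : linear_part (x *+ d) v = linear_part x v *+ d.
Proof. exact: (addfMn (linear_partE v)). Qed.

Lemma Fil_linear_part e x : divisible (p ^ (k * e)) x -> Fil p (k * e.+1) (linear_part x).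
Proof.
move=> dx; apply: Fil_sum => i _; apply: FilMn; apply: Fil_Phi; exact: divisibleMn.
Qed.

Lemma analytic_op_linear_part b F v : analytic_op p k b 0 F ->
  analytic_op p k b 0 (fun s w => linear_part (F s v) w).
Proof.
elim=> [F0 F00|a f F0 F1 ba Ff _ IH F1E].
  by apply: analytic_op_nil => t w; rewrite F00 linear_part0l.
apply: (analytic_op_cons (f := fun w => linear_part (f v) w) ba _ IH) => [|t w].
  by apply: Fil_le (Fil_linear_part (_ : divisible (p ^ (k * maxn a 0)) _)); [rewrite leq_mul2l leqnSn orbT|case: Ff].
by rewrite F1E linear_partDl linear_partMnl.
Qed.

(** The average of the action over two variables is symmetric in them; expanding
    it with the homomorphism property gives the left symmetry of the associator. *)
Lemma linear_part_symmetric x y v :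
  linear_part x (linear_part y v) - linear_part (linear_part x y) v =
  linear_part y (linear_part x v) - linear_part (linear_part y x) v.
Proof.
pose S x y := avg (fun s => avg (fun t => Phi (x *+ s + y *+ t) v)).
have SE x' y' : S x' y' = linear_part x' (linear_part y' v) - linear_part (linear_part x' y') v.
  move: x' y' => {}x {}y.
  have HF := analytic_op_Phi_linear x.
  have [F' [F2 [HF' HF2 F'E FF]]] := analytic_op_inverse expk (isT : 0 < 1)%N HF.
  have inner s : avg (fun t => Phi (x *+ s + y *+ t) v) =
      linear_part (y + F' s y) v + Phi (x *+ s) (linear_part (y + F' s y) v).
    rewrite (avg_ext (X' := fun t => Phi (x *+ s) v + Phi ((y + F' s y) *+ t) v
       + Phi (x *+ s) (Phi ((y + F' s y) *+ t) v))).
      by rewrite avgD avgD avg_const add0r (avg_addf _ (PhiD _)).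
    move=> t; rewrite mulrnDl -(addfMn (analytic_op_addf s HF')).
    exact: (Phi_solve (F := fun t v => Phi (x *+ t) v) (Y := fun t => x *+ t) _ _ (fun=> erefl) (FF s)).
  rewrite /S (avg_ext inner) avgD.
  have -> : avg (fun s => Phi (x *+ s) (linear_part (y + F' s y) v)) = linear_part x (linear_part y v).
    rewrite (avg_ext (X' := fun s => Phi (x *+ s) (linear_part y v) + Phi (x *+ s) (linear_part (F' s y) v))).
      rewrite avgD.
      have -> : avg (fun s => Phi (x *+ s) (linear_part (F' s y) v)) = 0.
        apply: (@avg_analytic_op (fun s w => Phi (x *+ s) (linear_part (F' s y) w))).
        by apply: analytic_op_weak (analytic_op_comp HF (analytic_op_linear_part y HF')).
      by rewrite addr0.
    by move=> s; rewrite linear_partDl PhiD.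
  rewrite addrC; congr (_ + _).
  rewrite (avg_ext (X' := fun s => linear_part y v + - linear_part (Phi (x *+ s) y) v + linear_part (F2 s y) v)).
    rewrite avgD avgD avg_const add0r.
    have -> : avg (fun s => linear_part (F2 s y) v) = 0.
      by apply: (@avg_analytic_op (fun s w => linear_part (F2 s y) w)); apply: analytic_op_linear_part.
    rewrite addr0 (avg_addf (f := fun z => - linear_part z v)) // => z z'.
    by rewrite linear_partDl opprD.
  by move=> s; rewrite F'E addrA linear_partDl linear_partDl linear_partNl.
rewrite -!SE /S /avg.
under eq_bigr => i _ do rewrite -sumrMnl.
under [RHS]eq_bigr => i _ do rewrite -sumrMnl.
rewrite exchange_big; apply: eq_bigr => i _; apply: eq_bigr => j _.
by rewrite mulrnAC [_ *+ _ + _]addrC.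
Qed.

End LinearPart.

(** * Rational functional calculus *)

(** Legendre's bound: $(p - 1) v_p(s!) < s$ for $s > 0$. *)
Lemma leq_logn_fact p i : prime p -> (logn p (i.+1)`! * p.-1 <= i)%N.
Proof.
move=> p_pr; rewrite logn_fact // big_add1 /= -ltnS mulnC.
suff H d s : (0 < s)%N -> (p.-1 * (\sum_(0 <= k < d) s %/ p ^ k.+1) < s)%N by apply: H.
elim: d s => [|d IH] s s0; first by rewrite big_geq // muln0.
rewrite big_nat_recl // expn1.
under eq_bigr => j _ do rewrite expnS divnMA.
have [s'0|s'0] := posnP (s %/ p); first by rewrite s'0 big1 ?muln0 // => j _; rewrite div0n.
have := IH _ s'0; have := leq_trunc_div s p; have := prime_gt1 p_pr.
move: (\sum_(0 <= _ < _) _)%N => S; move: (s %/ p)%N s'0 => q.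
by case: (p) => // r; rewrite /=; nia.
Qed.

Section RationalScalars.
Variables (p n : nat) (V : zmodType).
Hypothesis p_prime : prime p.
Hypothesis V0 : forall x : V, x *+ p ^ n = 0.

(** Membership in the localization $\mathbb{Z}_{(p)}$, which acts on every group
    killed by $p^n$ through [rat_scale]. *)
Definition p_integral (u : rat) : Prop :=
  exists d z, coprime d p /\ u * d%:R = z%:~R.

Lemma p_integral_int z : p_integral z%:~R.
Proof. by exists 1%N, z; rewrite coprime1n mulr1. Qed.

Lemma p_integralM u w : p_integral u -> p_integral w -> p_integral (u * w).
Proof.
move=> [d [y [cd dE]]] [e [z [ce eE]]]; exists (d * e)%N, (y * z).
by rewrite coprimeMl cd ce natrM intrM -dE -eE; split=> //; ring.
Qed.

Lemma p_integralD u w : p_integral u -> p_integral w -> p_integral (u + w).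
Proof.
move=> [d [y [cd dE]]] [e [z [ce eE]]]; exists (d * e)%N, (y * e%:Z + z * d%:Z).
rewrite coprimeMl cd ce natrM intrD !intrM -dE -eE !pmulrn; split=> //; ring.
Qed.

Lemma p_integral_sum I (r : seq I) (P : pred I) (F : I -> rat) :
  (forall i, P i -> p_integral (F i)) -> p_integral (\sum_(i <- r | P i) F i).
Proof.
by move=> H; elim/big_ind: _ => //; [exact: (p_integral_int 0)|exact: p_integralD].
Qed.

Lemma p_integral_denq u : p_integral u -> coprime `|denq u| p.
Proof.
move=> [d [z [cd dE]]].
have E : numq u * d%:Z = z * denq u.
  apply: (@intr_inj rat); rewrite !intrM -dE numqE -pmulrn; ring.
have : (denq u %| d%:Z)%Z.
  rewrite -(@Gauss_dvdzr (denq u) (numq u)); first by rewrite E dvdz_mull.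
  by rewrite coprimezE coprime_sym coprime_num_den.
by rewrite dvdzE /= => /coprime_dvdl; apply.
Qed.

Definition rat_scale (u : rat) (v : V) : V :=
  v *~ numq u *+ invmod (p ^ n)%N `|denq u|%N.

Lemma rat_scaleE u v d z : p_integral u -> u * d%:R = z%:~R -> rat_scale u v *+ d = v *~ z.
Proof.
move=> /p_integral_denq cu dE; apply: (mulrn_coprime_inj p_prime V0 cu).
have E : numq u * d%:Z = z * denq u.
  apply: (@intr_inj rat); rewrite !intrM -dE numqE -pmulrn; ring.
rewrite /rat_scale; set w := v *~ _; set e := invmod _ _.
have -> : w *+ e *+ d *+ `|denq u| = w *+ (`|denq u| * e) *+ d.
  by rewrite -!mulrnA; congr (_ *+ _); ring.
by rewrite (invmodP p_prime V0) // !pmulrn -!mulrzA absz_denq E.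
Qed.

Lemma rat_scale_uniq u v w d z : coprime d p -> u * d%:R = z%:~R -> w *+ d = v *~ z ->
  rat_scale u v = w.
Proof.
move=> cd dE wE; apply: (mulrn_coprime_inj p_prime V0 cd).
by rewrite wE; apply: (rat_scaleE v _ dE); exists d, z.
Qed.

Lemma rat_scale_addf u : addf (rat_scale u).
Proof. by move=> x y; rewrite /rat_scale mulrzDl mulrnDl. Qed.

Lemma rat_scale_map f u v : addf f -> f (rat_scale u v) = rat_scale u (f v).
Proof. by move=> fD; rewrite /rat_scale addfMn // addfMz. Qed.

Lemma rat_scaleD u w v : p_integral u -> p_integral w ->
  rat_scale (u + w) v = rat_scale u v + rat_scale w v.
Proof.
move=> pu pw; have [d [y [cd dE]]] := pu; have [e [z [ce eE]]] := pw.
apply: (@rat_scale_uniq _ _ _ (d * e)%N (y * e%:Z + z * d%:Z)).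
- by rewrite coprimeMl cd ce.
- by rewrite natrM intrD !intrM -dE -eE !pmulrn; ring.
rewrite mulrnDl mulrnA (rat_scaleE v pu dE) mulnC mulrnA (rat_scaleE v pw eE).
by rewrite !pmulrn -!mulrzA mulrzDr.
Qed.

Lemma rat_scaleM u w v : p_integral u -> p_integral w ->
  rat_scale (u * w) v = rat_scale u (rat_scale w v).
Proof.
move=> pu pw; have [d [y [cd dE]]] := pu; have [e [z [ce eE]]] := pw.
apply: (@rat_scale_uniq _ _ _ (d * e)%N (y * z)).
- by rewrite coprimeMl cd ce.
- by rewrite natrM !intrM -dE -eE; ring.
rewrite mulrnA (rat_scaleE _ pu dE) [LHS]pmulrn mulrzAC -[rat_scale w v *~ _]pmulrn (rat_scaleE v pw eE).
by rewrite -mulrzA mulrC.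
Qed.

Lemma rat_scale_int z v : rat_scale z%:~R v = v *~ z.
Proof. by apply: (@rat_scale_uniq _ _ _ 1%N z); rewrite ?coprime1n ?mulr1. Qed.

Lemma rat_scale_sum I (r : seq I) (P : pred I) (F : I -> rat) v :
  (forall i, P i -> p_integral (F i)) ->
  rat_scale (\sum_(i <- r | P i) F i) v = \sum_(i <- r | P i) rat_scale (F i) v.
Proof.
move=> H; suff : p_integral (\sum_(i <- r | P i) F i) /\
  rat_scale (\sum_(i <- r | P i) F i) v = \sum_(i <- r | P i) rat_scale (F i) v by case.
elim: r => [|i r [IH1 IH2]].
  by rewrite !big_nil; split; [exact: (p_integral_int 0)|rewrite (rat_scale_int 0)].
rewrite !big_cons; case Pi: (P i) => //.
by split; [apply: p_integralD => //; apply: H|rewrite rat_scaleD ?IH2 //; apply: H].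
Qed.

Lemma p_integral_div_fact (N i : nat) : (0 < N <= p.-1)%N ->
  p_integral (p%:R ^+ (i %/ N) / (i.+1)`!%:R).
Proof.
move=> /andP[N0 Np]; have [u cu uE] := pfactor_coprime p_prime (fact_gt0 i.+1).
have p0 : p%:R != 0 :> rat by rewrite pnatr_eq0 -lt0n prime_gt0.
have le_v : (logn p (i.+1)`! <= i %/ N)%N.
  apply: leq_trans (leq_div2l i N0 Np).
  by rewrite leq_divRL ?(leq_trans N0) //; apply: leq_logn_fact.
exists u, ((p ^ (i %/ N - logn p (i.+1)`!))%N%:Z); rewrite coprime_sym; split=> //.
have u0 : u%:R != 0 :> rat.
  rewrite pnatr_eq0; apply/eqP => u0; move: (fact_gt0 i.+1); by rewrite uE u0 mul0n.
rewrite {1}uE natrM natrX -pmulrn natrX -{1}(subnK le_v) exprD.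
by field; rewrite u0 expf_neq0.
Qed.

End RationalScalars.

(** * Exponential and logarithm *)

Section ExpLog.
Variable K : nat.

(** Truncations of $\log(1 + X)/X$ and of $(e^Y - 1)/Y$ at $Y = \log(1 + X)$. *)
Definition logq : {poly rat} := \poly_(i < K) ((-1) ^+ i / i.+1%:R).

Definition expq : {poly rat} := \sum_(a < K) (a.+1)`!%:R^-1 *: ('X * logq) ^+ a.

Let y := 'X * logq.
Let E0 : {poly rat} := \sum_(a < K) (a`!%:R^-1)%:P * y ^+ a.
Let F := E0 + (K`!%:R^-1)%:P * y ^+ K.

Let FE : F = 1 + y * expq.
Proof.
have -> : F = \sum_(a < K.+1) (a`!%:R^-1)%:P * y ^+ a by rewrite big_ord_recr.
rewrite big_ord_recl fact0 expr0 invr1 mulr1; congr (_ + _).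
rewrite /expq mulr_sumr; apply: eq_bigr => a _.
by rewrite -mul_polyC lift0 exprS mulrCA.
Qed.

Let deriv_y : (1 + 'X) * y^`() = 1 - (- 'X) ^+ K.
Proof.
have -> : y^`() = \sum_(i < K) (- 'X) ^+ i.
  rewrite /y /logq poly_def mulr_sumr raddf_sum; apply: eq_bigr => i _ /=.
  rewrite -scalerAr -exprS derivZ derivXn /= -scaler_nat scalerA divfK ?pnatr_eq0 //.
  by rewrite -mul_polyC rmorphXn rmorphN1 [RHS]exprNn.
rewrite -[RHS]opprB subrX1 -mulNr opprB opprK //.
Qed.

Let deriv_F : (1 + 'X) * F^`() = (1 - (- 'X) ^+ K) * E0.
Proof.
rewrite -deriv_y -mulrA; congr (_ * _).
have -> : F = \sum_(a < K.+1) (a`!%:R^-1)%:P * y ^+ a by rewrite big_ord_recr.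
rewrite raddf_sum big_ord_recl /= expr0 mulr1 derivC add0r mulr_sumr.
apply: eq_bigr => a _; rewrite /bump /= add1n deriv_mulC deriv_exp /= -mulrnAr mulrCA; congr (_ * _).
rewrite mulrnAr -mulr_natl mulrA -polyC_natr -polyCM factS natrM invfM mulrA divff ?mul1r //.
by rewrite pnatr_eq0.
Qed.

Let F0 : F`_0 = 1.
Proof. by rewrite FE coefD coef1 -mulrA coefXM addr0. Qed.

Let F_rec i : (i < K)%N -> F`_i = F`_i.+1 *+ i.+1 + F`_i *+ i.
Proof.
move=> iK.
have cF : ((1 + 'X) * F^`())`_i = F`_i.
  rewrite deriv_F mulrBl mul1r /F coefB coefD; congr (_ + _).
  have -> : (- 'X) ^+ K = ((-1) ^+ K)%:P * 'X^K :> {poly rat}.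
    by rewrite [LHS]exprNn polyC_exp polyCN.
  by rewrite -mulrA !coefCM exprMn !coefXnM iK !mulr0 oppr0.
rewrite -{1}cF mulrDl mul1r coefD coefXM !coef_deriv; congr (_ + _).
by case: (i).
Qed.

(** The series $F = e^Y$ satisfies $(1 + X) F' = F$ and $F(0) = 1$ up to high
    order terms, so that $F = 1 + X$; then divide $F - 1$ by $X$. *)
Lemma coef_expq_logq i : (i < K)%N -> (expq * logq)`_i = (i == 0%N)%:R.
Proof.
move=> iK; have -> : (expq * logq)`_i = F`_i.+1.
  by rewrite FE coefD coef1 add0r /y -mulrA coefXM /= mulrC.
elim: i iK => [|i IH] iK.
  by have := F_rec iK; rewrite mulr0n addr0 mulr1n F0.
have := F_rec iK; rewrite IH ?(ltnW iK) //; case: i {IH} iK => [|i] iK.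
  by move/eqP; rewrite -subr_eq0 opprD addrCA subrr addr0 oppr_eq0 mulrn_eq0 => /eqP.
rewrite mul0rn addr0 => /esym/eqP; rewrite mulrn_eq0 => /eqP //.
Qed.

End ExpLog.

(** * Functional calculus on operators *)

Section Split.
Variables (p m : nat) (G : finZmodType).

Definition pdivide (x : G) : G := odflt 0 [pick y | x == y *+ p].

Lemma pdivideP x : divisible p x -> x = pdivide x *+ p.
Proof.
case=> y yE; rewrite /pdivide; case: pickP => [z /eqP //|/(_ y)].
by rewrite -yE eqxx.
Qed.

(** The operator $f^{2m}/p$. *)
Definition pow2m_div (f : G -> G) v := iter m f (pdivide (iter m f v)).

Variable f : G -> G.
Hypothesis fD : addf f.
Hypothesis Ff : Fil p 1 (iter m f).

(** Two quotients by [p] differ by an element of order [p], which $f^m$ kills. *)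
Lemma pow2m_div_uniq u v : u *+ p = iter m f v -> pow2m_div f v = iter m f u.
Proof.
have [_ fd fa] := Ff; have fmD := addf_iter m fD => uE.
apply/eqP; rewrite -subr_eq0 -(addfB fmD); apply/eqP.
rewrite -[LHS]mulr1n -(expn0 p); apply: fa; rewrite add0n expn1 mulrnBl uE -pdivideP ?subrr //.
Qed.

Lemma pow2m_div_div v : exists2 u, u *+ p = iter m f v & pow2m_div f v = iter m f u.
Proof.
have [_ /(_ v)[u uE] _] := Ff; exists u; first by rewrite uE expn1.
by apply: pow2m_div_uniq; rewrite uE expn1.
Qed.

Lemma pow2m_div_addf : addf (pow2m_div f).
Proof.
move=> v w; have [x xE ->] := pow2m_div_div v; have [y yE ->] := pow2m_div_div w.
rewrite -(addf_iter m fD); apply: pow2m_div_uniq.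
by rewrite mulrnDl xE yE (addf_iter m fD).
Qed.

Lemma pow2m_div_comm g v : addf g -> (forall v, g (f v) = f (g v)) ->
  pow2m_div f (g v) = g (pow2m_div f v).
Proof.
move=> gD gf; have gfi i w : g (iter i f w) = iter i f (g w).
  by elim: i => //= i IH; rewrite gf IH.
have [u uE ->] := pow2m_div_div v; rewrite gfi; apply: pow2m_div_uniq.
by rewrite -(addfMn gD) uE gfi.
Qed.

Lemma pow2m_div_p v : pow2m_div f v *+ p = iter m.*2 f v.
Proof.
have [u uE ->] := pow2m_div_div v; rewrite -(addfMn (addf_iter m fD)) uE.
by rewrite -iterD addnn.
Qed.

Lemma pow2m_div_divisible v : divisible p (pow2m_div f v).
Proof.
by have [u uE ->] := pow2m_div_div v; have [_ /(_ u)] := Ff; rewrite expn1.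
Qed.

End Split.

Section Operators.
Variables (p n m : nat) (G : finZmodType) (L : G -> G).
Hypothesis p_prime : prime p.
Hypothesis V0 : forall x : G, x *+ p ^ n = 0.
Hypothesis m_gt0 : (0 < m)%N.
Hypothesis le_m : (m.*2 <= p.-1)%N.
Hypothesis LD : addf L.
Hypothesis FL : Fil p 1 (iter m L).

Let N := m.*2.
Let N_gt0 : (0 < N)%N. Proof. by rewrite double_gt0. Qed.
Let sigma := pow2m_div p m L.
Let sigmaD : addf sigma := pow2m_div_addf LD FL.
Let K := (N * n)%N.
Local Notation rat_scale := (@rat_scale p n G).
Local Notation rat_scaleM := (@rat_scaleM p n G p_prime V0).
Local Notation rat_scale_addf := (@rat_scale_addf p n G).

(** The operator $L^i / p^{\lfloor i/N \rfloor}$. These operators multiply like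
    the monomials $X^i / p^{\lfloor i/N \rfloor}$, up to a factor [p] when the
    remainders modulo [N] produce a carry. *)
Definition x_op i v := iter (i %% N) L (iter (i %/ N) sigma v).

Let iterLD i : addf (iter i L). Proof. exact: addf_iter. Qed.
Let iterSD i : addf (iter i sigma). Proof. exact: addf_iter. Qed.

Lemma x_op_addf i : addf (x_op i).
Proof. by move=> u v; rewrite /x_op iterSD iterLD. Qed.

Let iter_comm g i v : addf g -> (forall v, g (L v) = L (g v)) ->
  iter i sigma (g v) = g (iter i sigma v).
Proof.
by move=> gD gL; elim: i => //= i ->; apply: pow2m_div_comm.
Qed.

Lemma x_op_comm g i v : addf g -> (forall v, g (L v) = L (g v)) -> x_op i (g v) = g (x_op i v).
Proof.
move=> gD gL; rewrite /x_op iter_comm //.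
by elim: (i %% N)%N => //= j ->.
Qed.

Let iterN v : iter N L v = sigma v *+ p.
Proof. by rewrite /sigma pow2m_div_p. Qed.

Lemma x_op_M i j v :
  x_op i (x_op j v) = x_op (i + j) v *+ p ^ ((i + j) %/ N - i %/ N - j %/ N).
Proof.
have LS a b w : iter a sigma (iter b L w) = iter b L (iter a sigma w).
  by apply: iter_comm => // u; rewrite -iterSr.
rewrite /x_op LS -!iterD divnD // modnD //.
move: (i %/ N)%N (j %/ N)%N => a b.
case: ltnP => le_N.
  by rewrite (_ : (_ + _ + _ - _ - _)%N = 0%N) ?addn0 ?subn0 ?expn0 ?mulr1n //; lia.
rewrite (_ : (_ + _ + _ - _ - _)%N = 1%N); last by lia.
rewrite mul1n expn1 addn1 -{1}(subnK le_N) iterD.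
by rewrite [iter N _ _]iterN addfMn // iterS.
Qed.

Lemma x_op_div i v : (N <= i)%N -> divisible p (x_op i v).
Proof.
move=> Ni; have q0 : (0 < i %/ N)%N by rewrite divn_gt0.
rewrite /x_op -(prednK q0) iterS; apply: (addf_divisible (iterLD _)).
exact: pow2m_div_divisible.
Qed.

Lemma x_op0 i v : (K <= i)%N -> x_op i v = 0.
Proof.
move=> Ki; have le_n : (n <= i %/ N)%N by rewrite leq_divRL // mulnC.
have dv q : divisible (p ^ q) (iter q sigma v).
  elim: q => [|q [y yE]]; first by exists v.
  rewrite iterS yE addfMn // expnSr.
  have [z zE] := pow2m_div_divisible LD FL y; exists z.
  by rewrite /sigma zE -mulrnA mulnC.
have [y yE] := dv (i %/ N)%N.
by rewrite /x_op yE -(subnK le_n) expnD mulrnA V0 addf0.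
Qed.

Lemma x_op_exp i v : x_op i v *+ p ^ (i %/ N) = iter i L v.
Proof.
rewrite /x_op [in RHS](divn_eq i N) [in RHS]addnC iterD -(addfMn (iterLD _)); congr (iter _ _ _).
elim: (i %/ N)%N => [|q IH]; first by rewrite mul0n.
by rewrite mulSn iterD -IH iterN addfMn // expnS mulrnA mulrnAC.
Qed.

(** The ring $\mathbb{Z}_{(p)}[X, X^N/p]$. *)
Definition evaluable (f : {poly rat}) := forall i, p_integral p (p%:R ^+ (i %/ N) * f`_i).

(** The ring homomorphism that maps $X$ to $L$ and $X^N/p$ to $L^N/p$. *)
Definition ev (f : {poly rat}) v :=
  \sum_(i < K) rat_scale (p%:R ^+ (i %/ N) * f`_i) (x_op i v).

Lemma ev_addf f : addf (ev f).
Proof.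
move=> u v; rewrite /ev -big_split; apply: eq_bigr => i _ /=.
by rewrite x_op_addf rat_scale_addf.
Qed.

Lemma ev_comm g f v : addf g -> (forall v, g (L v) = L (g v)) -> ev f (g v) = g (ev f v).
Proof.
move=> gD gL; rewrite /ev addf_sum //; apply: eq_bigr => i _.
by rewrite x_op_comm // rat_scale_map.
Qed.

Lemma ev_trunc (f g : {poly rat}) v : (forall i, (i < K)%N -> f`_i = g`_i) -> ev f v = ev g v.
Proof. by move=> e; apply: eq_bigr => i _; rewrite e. Qed.

Lemma evaluable_sum I (r : seq I) (P : pred I) (F : I -> {poly rat}) :
  (forall i, P i -> evaluable (F i)) -> evaluable (\sum_(i <- r | P i) F i).
Proof.
move=> H i; rewrite coef_sum mulr_sumr; apply: p_integral_sum => j Pj; exact: H.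
Qed.

Lemma ev_sum I (r : seq I) (P : pred I) (F : I -> {poly rat}) v :
  (forall i, P i -> evaluable (F i)) ->
  ev (\sum_(i <- r | P i) F i) v = \sum_(i <- r | P i) ev (F i) v.
Proof.
move=> H; rewrite /ev exchange_big; apply: eq_bigr => i _ /=.
rewrite coef_sum mulr_sumr rat_scale_sum // => j Pj; exact: H.
Qed.

Let carry i j := ((i + j) %/ N - i %/ N - j %/ N)%N.

Let carryE i j : ((i + j) %/ N = carry i j + i %/ N + j %/ N)%N.
Proof.
have : (i %/ N + j %/ N <= (i + j) %/ N)%N by rewrite divnD // leq_addr.
by rewrite /carry; move: (i %/ N)%N (j %/ N)%N ((i + j) %/ N)%N => a b c; lia.
Qed.

Let coef_mul_split (f g : {poly rat}) i j :
  p%:R ^+ ((i + j) %/ N) * (f`_i * g`_j) =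
  ((p ^ carry i j)%N%:Z)%:~R * ((p%:R ^+ (i %/ N) * f`_i) * (p%:R ^+ (j %/ N) * g`_j)).
Proof. by rewrite carryE !exprD -pmulrn natrX; ring. Qed.

Lemma evaluable_M f g : evaluable f -> evaluable g -> evaluable (f * g).
Proof.
move=> ef eg l; rewrite coefM mulr_sumr; apply: p_integral_sum => j _.
rewrite -{1}(subnKC (_ : j <= l)%N) ?coef_mul_split; last by rewrite -ltnS.
by apply: p_integralM; [exact: p_integral_int|exact: p_integralM].
Qed.

Let sum_triangle (T : nat -> nat -> G) :
  (forall i j, (K <= i + j)%N -> T i j = 0) ->
  \sum_(i < K) \sum_(j < K) T i j = \sum_(l < K) \sum_(j < l.+1) T j (l - j)%N.
Proof.
move=> T0.
transitivity (\sum_(j < K) \sum_(l < K | (j <= l)%N) T j (l - j)%N); last first.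
  rewrite (exchange_big_dep xpredT) //=; apply: eq_bigr => l _.
  rewrite [RHS](big_ord_widen _ (fun j => T j (l - j)%N) (ltn_ord l)).
  by apply: eq_bigl => j; rewrite ltnS.
apply: eq_bigr => j _.
transitivity (\sum_(0 <= i < K - j) T j i).
  rewrite -(big_mkord xpredT (T j)) (@big_cat_nat _ _ _ (K - j)) ?leq_subr //=.
  rewrite [X in _ + X]big_nat_cond [X in _ + X]big1 ?addr0 // => i /andP[/andP[l _] _].
  by apply: T0; rewrite -leq_subLR.
rewrite -(big_mkord (fun l => (j <= l)%N) (fun l => T j (l - j)%N)).
rewrite [RHS](@big_cat_nat _ _ _ j) //=; last exact: ltnW (ltn_ord j).
rewrite [X in _ = X + _]big_nat_cond [X in _ = X + _]big_pred0 ?add0r; last first.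
  by move=> i /=; apply/negbTE/negP=> /andP[lt_i le_i]; move: le_i; rewrite leqNgt lt_i.
have := @big_addn G 0 +%R 0 K j (fun l => (j <= l)%N) (fun l => T j (l - j)%N).
rewrite add0n => ->.
by apply: eq_big => [i|i _]; rewrite ?leq_addl ?addnK.
Qed.

Lemma ev_M f g v : evaluable f -> evaluable g -> ev (f * g) v = ev f (ev g v).
Proof.
move=> ef eg.
pose T i j := rat_scale (p%:R ^+ ((i + j) %/ N) * (f`_i * g`_j)) (x_op (i + j) v).
transitivity (\sum_(l < K) \sum_(j < l.+1) T j (l - j)%N).
  apply: eq_bigr => l _; rewrite coefM mulr_sumr rat_scale_sum //.
    by apply: eq_bigr => j _; rewrite /T subnKC // -ltnS.
  move=> j _; rewrite -{1}(subnKC (_ : j <= l)%N) ?coef_mul_split; last by rewrite -ltnS.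
  by apply: p_integralM; [exact: p_integral_int|exact: p_integralM].
rewrite -sum_triangle; last first.
  move=> i j le_ij; by rewrite /T x_op0 // (addf0 (rat_scale_addf _)).
apply: eq_bigr => i _; rewrite /ev (addf_sum (x_op_addf i)) (addf_sum (rat_scale_addf _)).
apply: eq_bigr => j _; rewrite (rat_scale_map _ _ _ _ (x_op_addf i)) x_op_M -/(carry i j).
rewrite /T coef_mul_split rat_scaleM; [|exact: p_integral_int|exact: p_integralM].
by rewrite rat_scale_int // -pmulrn rat_scaleM // -!(addfMn (rat_scale_addf _)).
Qed.

Lemma ev_monomial c i v : ev (c *: 'X^i) v = rat_scale (p%:R ^+ (i %/ N) * c) (x_op i v).
Proof.
rewrite /ev; have [iK|Ki] := ltnP i K.
  rewrite (bigD1 (Ordinal iK)) //= coefZ coefXn eqxx mulr1 big1 ?addr0 // => j ji.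
  rewrite coefZ coefXn (negbTE (ji : j != i :> nat)).
  by rewrite !mulr0 (rat_scale_int p_prime V0 0) mulr0z.
rewrite big1 => [|j _]; last first.
  rewrite coefZ coefXn (negbTE (_ : j != i :> nat)) ?mulr0; last by rewrite neq_ltn (leq_trans (ltn_ord j)).
  by rewrite (rat_scale_int p_prime V0 0) mulr0z.
by rewrite x_op0 // (addf0 (rat_scale_addf _)).
Qed.

Lemma evaluable_monomial c i : p_integral p (p%:R ^+ (i %/ N) * c) -> evaluable (c *: 'X^i).
Proof.
move=> H j; rewrite coefZ coefXn; have [->|_] := eqVneq j i; first by rewrite mulr1.
by rewrite !mulr0; apply: (p_integral_int p 0).
Qed.

Lemma x_op_0 v : x_op 0 v = v.
Proof. by rewrite /x_op mod0n div0n. Qed.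

Lemma evaluable_const c : p_integral p c -> evaluable c%:P.
Proof.
move=> H; rewrite -[c%:P]mulr1 -[1]/('X^0 : {poly rat}) mul_polyC.
by apply: evaluable_monomial; rewrite div0n mul1r.
Qed.

Lemma ev_const c v : ev c%:P v = rat_scale c v.
Proof. by rewrite -[c%:P]mulr1 -[1]/('X^0 : {poly rat}) mul_polyC ev_monomial div0n mul1r x_op_0. Qed.

Lemma ev_1 v : ev 1 v = v.
Proof. by rewrite -[1]/(1%:P : {poly rat}) ev_const (rat_scale_int p_prime V0 1). Qed.

Lemma evaluable_1 : evaluable 1.
Proof. by rewrite -[1]/(1%:P : {poly rat}); apply: evaluable_const; apply: (p_integral_int p 1). Qed.

Lemma evaluable_exp f a : evaluable f -> evaluable (f ^+ a).
Proof.
move=> ef; elim: a => [|a IH]; first exact: evaluable_1.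
by rewrite exprS; apply: evaluable_M.
Qed.

Lemma ev_exp f a v : evaluable f -> ev (f ^+ a) v = iter a (ev f) v.
Proof.
move=> ef; elim: a => [|a IH]; first by rewrite ev_1.
by rewrite exprS ev_M ?IH //; apply: evaluable_exp.
Qed.

Let N_gt1 : (1 < N)%N. Proof. by rewrite /N; move: m_gt0; case: (m) => // q _; rewrite doubleS. Qed.

Lemma evaluable_X : evaluable 'X.
Proof.
rewrite -['X]scale1r -[X in _ *: X]expr1; apply: evaluable_monomial.
by rewrite divn_small // mulr1; apply: (p_integral_int p 1).
Qed.

Lemma ev_X v : ev 'X v = L v.
Proof.
rewrite -['X]scale1r -[X in _ *: X]expr1 ev_monomial divn_small // mulr1.
by rewrite (rat_scale_int p_prime V0 1) /x_op modn_small // divn_small.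
Qed.

Let p_neq0 : p%:R != 0 :> rat.
Proof. by rewrite pnatr_eq0 -lt0n prime_gt0. Qed.

Let sigmaq : {poly rat} := p%:R^-1 *: 'X^N.

Let evaluable_sigmaq : evaluable sigmaq.
Proof.
by apply: evaluable_monomial; rewrite divnn N_gt0 expr1 mulfV //; apply: (p_integral_int p 1).
Qed.

Let ev_sigmaq v : ev sigmaq v = sigma v.
Proof.
rewrite ev_monomial divnn N_gt0 expr1 mulfV // (rat_scale_int p_prime V0 1) /x_op modnn divnn N_gt0 //.
Qed.

Let N_le : (0 < N <= p.-1)%N. Proof. by rewrite N_gt0. Qed.

(** The operator $L^i / (i+1)!$. *)
Definition pow_div_fact i v := rat_scale (p%:R ^+ (i %/ N) / (i.+1)`!%:R) (x_op i v).

Let fact_neq0 i : i`!%:R != 0 :> rat. Proof. by rewrite pnatr_eq0 -lt0n fact_gt0. Qed.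

Lemma pow_div_fact_fact i v : pow_div_fact i v *+ (i.+1)`! = iter i L v.
Proof.
rewrite /pow_div_fact (@rat_scaleE p n G p_prime V0 _ _ _ (p ^ (i %/ N))%N); last 2 first.
- exact: p_integral_div_fact.
- by rewrite divfK // -pmulrn natrX.
by rewrite -pmulrn x_op_exp.
Qed.

Lemma pow_div_fact_addf i : addf (pow_div_fact i).
Proof. by move=> u v; rewrite /pow_div_fact x_op_addf rat_scale_addf. Qed.

Lemma pow_div_fact0 i v : (K <= i)%N -> pow_div_fact i v = 0.
Proof. by move=> Ki; rewrite /pow_div_fact x_op0 // (addf0 (rat_scale_addf _)). Qed.

Lemma iter_L0 i v : (K <= i)%N -> iter i L v = 0.
Proof. by move=> Ki; rewrite -pow_div_fact_fact pow_div_fact0 // mul0rn. Qed.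

Let logq_coef i : p%:R ^+ (i %/ N) * ((-1) ^+ i / i.+1%:R) =
  ((-1) ^+ i * (i`!)%:Z)%:~R * (p%:R ^+ (i %/ N) / (i.+1)`!%:R) :> rat.
Proof.
rewrite intrM rmorphXn /= rmorphN1 -pmulrn factS natrM.
by field; rewrite fact_neq0 nat1r pnatr_eq0.
Qed.

Lemma evaluable_logq : evaluable (logq K).
Proof.
move=> i; rewrite coef_poly; case: ifP => _; last by rewrite mulr0; apply: (p_integral_int p 0).
rewrite logq_coef; apply: p_integralM; [exact: p_integral_int|exact: p_integral_div_fact].
Qed.

(** The operator $\log(1 + L)/L$. *)
Definition log_div v := ev (logq K) v.

Lemma log_divE v : log_div v = \sum_(i < K) pow_div_fact i v *~ ((-1) ^+ i * (i`!)%:Z).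
Proof.
apply: eq_bigr => i _; rewrite coef_poly ltn_ord logq_coef rat_scaleM; last 2 first.
- exact: p_integral_int.
- exact: p_integral_div_fact.
by rewrite (rat_scale_int p_prime V0).
Qed.

Lemma log_div_addf : addf log_div. Proof. exact: ev_addf. Qed.

Lemma log_div_L v : log_div (L v) = L (log_div v).
Proof. exact: ev_comm. Qed.

(** The operator $\log(1 + L)$. *)
Definition log_op v := L (log_div v).

Lemma log_op_addf : addf log_op. Proof. exact: addf_comp LD log_div_addf. Qed.

Lemma iter_log_op i v : iter i log_op v = iter i L (iter i log_div v).
Proof.
have comm j w : iter j L (log_div w) = log_div (iter j L w).
  by elim: j => //= j ->; rewrite log_div_L.
elim: i => // i IH; rewrite [LHS]iterS IH [in RHS]iterS [in RHS]iterS.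
by rewrite /log_op comm.
Qed.

Lemma Fil_log_op : Fil p 1 (iter m log_op).
Proof.
apply: Fil_ext (fun v => esym (iter_log_op m v)) _.
exact: Fil_comp FL (Fil0 p (addf_iter m log_div_addf)).
Qed.

Let pow2m_div_log_op v : pow2m_div p m log_op v = sigma (iter N log_div v).
Proof.
have [u uE ->] := pow2m_div_div log_op_addf Fil_log_op v.
have commN i j w : iter i L (iter j log_div w) = iter j log_div (iter i L w).
  elim: i => //= i ->; elim: j (iter i L w) => //= j IH w'.
  by rewrite -IH log_div_L.
rewrite !iter_log_op in uE *; symmetry; apply: (pow2m_div_uniq LD FL).
rewrite -(addfMn (addf_iter m log_div_addf)) uE commN -iterD addnn.
by rewrite commN.
Qed.

(** The operator $(e^f - 1)/f$, for an operator $f$ whose power $f^m$ is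
    divisible by $p$. *)
Definition exp_div (f : G -> G) v := \sum_(a < K)
  rat_scale (p%:R ^+ (a %/ N) / (a.+1)`!%:R) (iter (a %% N) f (iter (a %/ N) (pow2m_div p m f) v)).

(** The formal identity [coef_expq_logq], evaluated at $L$. The summand
    $Y^a/(a+1)!$ is regrouped as $c_a Y^r (Y^N/p)^q$ with $a = qN + r$, where
    $c_a = p^q/(a+1)!$ is [p]-integral. *)
Lemma exp_log_div v : exp_div log_op (log_div v) = v.
Proof.
have eX := evaluable_X; have eS := evaluable_sigmaq; have eL := evaluable_logq.
have eT : evaluable ('X * logq K) by apply: evaluable_M.
have evT w : ev ('X * logq K) w = log_op w by rewrite ev_M // ev_X.
have eLN : evaluable (logq K ^+ N) by apply: evaluable_exp.
have eST : evaluable (sigmaq * logq K ^+ N) by apply: evaluable_M.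
have evST w : ev (sigmaq * logq K ^+ N) w = pow2m_div p m log_op w.
  by rewrite pow2m_div_log_op ev_M // ev_sigmaq ev_exp.
have term a : (a.+1)`!%:R^-1 *: ('X * logq K) ^+ a =
    (p%:R ^+ (a %/ N) / (a.+1)`!%:R)%:P *
     (('X * logq K) ^+ (a %% N) * (sigmaq * logq K ^+ N) ^+ (a %/ N)).
  rewrite {2}(divn_eq a N) [(_ * N)%N]mulnC exprD exprM mul_polyC.
  rewrite /sigmaq -scalerAl -exprMn exprZn -scalerAr scalerA; congr (_ *: _).
    by rewrite exprVn mulrAC mulfV ?mul1r // expf_neq0.
  by rewrite mulrC.
have eterm a : evaluable (('X * logq K) ^+ (a %% N) * (sigmaq * logq K ^+ N) ^+ (a %/ N)).
  by apply: evaluable_M; apply: evaluable_exp.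
have econst a : evaluable (p%:R ^+ (a %/ N) / (a.+1)`!%:R)%:P.
  by apply: evaluable_const; apply: p_integral_div_fact.
have eE : evaluable (expq K).
  apply: evaluable_sum => a _; rewrite term; exact: evaluable_M.
have -> : exp_div log_op (log_div v) = ev (expq K) (log_div v).
  rewrite /expq ev_sum; last by move=> a _; rewrite term; apply: evaluable_M.
  apply: eq_bigr => a _; rewrite term ev_M // ev_const ev_M; try exact: evaluable_exp.
  rewrite !ev_exp //; congr (rat_scale _ _).
  rewrite (eq_iter evST) -[LHS]/(iter _ _ _); exact: eq_iter.
rewrite /log_div -ev_M // -[RHS]ev_1; apply: ev_trunc => i iK.
by rewrite coef_expq_logq // coef1.
Qed.

(** Modulo [p] only the first [N] terms of the series remain, and these form a
    polynomial in $L$ with [p]-integral coefficients. *)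
Lemma log_div_stable (U : G -> Prop) v :
  U 0 -> (forall x y, U x -> U y -> U (x - y)) -> (forall x, U x -> U (L x)) ->
  U v -> exists2 u, U u & divisible p (log_div v - u).
Proof.
move=> U0 Usub UL Uv.
have Uopp x : U x -> U (- x) by move=> Ux; rewrite -[- x]add0r; apply: Usub.
have Uadd x y : U x -> U y -> U (x + y).
  by move=> Ux Uy; rewrite -[y]opprK; apply: Usub => //; apply: Uopp.
have UMn x d : U x -> U (x *+ d).
  by move=> Ux; elim: d => [|d IH]; rewrite ?mulrS //; apply: Uadd.
rewrite /log_div /ev.
elim/big_ind: _ => [|x y [u Uu du] [w Uw dw]|i _].
- by exists 0; rewrite ?subr0 //; apply: divisible0.
- by exists (u + w); [exact: Uadd|rewrite opprD addrACA; apply: divisibleD].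
have [iN|Ni] := ltnP i N; last first.
  exists 0 => //; rewrite subr0; apply: (addf_divisible (rat_scale_addf _)); exact: x_op_div.
exists (rat_scale (p%:R ^+ (i %/ N) * (logq K)`_i) (x_op i v)); last by rewrite subrr; apply: divisible0.
rewrite /rat_scale; apply: (UMn); rewrite /x_op modn_small // divn_small //=.
have Ui : U (iter i L v) by elim: (val i) => //= j; apply: UL.
by case: (numq _) => d; rewrite ?NegzE ?mulrNz -pmulrn; [|apply: (Uopp)]; apply: (UMn).
Qed.

End Operators.

(** * Logarithms of elements *)

Lemma leq_double_quarter p : ((p.-1 %/ 4).*2 <= p.-1)%N.
Proof. by have := leq_trunc_div p.-1 4; rewrite -muln2; lia. Qed.

Section Logarithm.
Variables (p n k : nat) (G : finZmodType) (circ : G -> G -> G) (gamma : int).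
Hypothesis adm : admissible p n circ.
Hypothesis expk : forall x : G, x *+ p ^ (k * p.-1) = 0.
Hypothesis gamma_prim : primitive_root_mod (p ^ n) gamma.
Let p_prime := adm_prime adm.
Let V0 := order_killed adm.
Let m := (p.-1 %/ 4)%N.
Let K := (m.*2 * n)%N.

Let le_m2 : (m.*2 <= p.-1)%N := leq_double_quarter p.

Variable a : G.
Notation L := (star circ a).
Let LD : addf L := starD adm a.
Let FL : Fil p 1 (iter m L) := Fil_star_m adm a.
Local Notation pow_div_fact := (pow_div_fact p n m L).

(** The logarithm of [a], and that of its action [lam circ a]. *)
Definition log_elt := log_div p n m L a.
Definition log_act := log_op p n m L.

Let rest w t := \sum_(i < K) \sum_(c < i)
  (pow_div_fact i w *~ stirling1 i.+1 c.+2) *+ p ^ (k * c.+1) *+ t ^ c.+2.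

(** The circle powers $a^{\circ p^k t}$ are divisible by $p^k$, and the quotient is an
    analytic function of $t$ whose linear term is the logarithm of $a$; the
    same expansion with $L_a v$ in place of the second $a$ computes the action. *)
Let pow_expansion w t : \sum_(i < p ^ k * t) iter i L w *+ 'C(p ^ k * t, i.+1) =
  (log_div p n m L w *+ t + rest w t) *+ p ^ k.
Proof.
rewrite (@sum_bin_trunc G K (fun i => iter i L w)); last first.
  by move=> j Kj; apply: (iter_L0 p_prime V0 (adm_m_gt0 adm) le_m2 LD FL).
rewrite (log_divE L p_prime V0 (adm_m_gt0 adm) le_m2) /rest -sumrMnl -big_split -sumrMnl.
apply: eq_bigr => i _ /=.
rewrite -(pow_div_fact_fact p_prime V0 (adm_m_gt0 adm) le_m2 LD FL) -mulrnA mulnC bin_ffact.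
rewrite pmulrn ffact_stirling1 mulrz_sumr big_ord_recl stirling1_0 mul0r mulr0z add0r.
have natE (c : nat) : (p ^ k * t)%N%:Z ^+ c = (p ^ (k * c) * t ^ c)%N%:Z.
  by rewrite -[in LHS]natz -natrX natz expnMn expnM.
rewrite big_ord_recl mulrnDl -sumrMnl; congr (_ + _).
  rewrite lift0 stirling1_1 mulrzA natE -pmulrn muln1 expn1.
  by rewrite mulnC mulrnA.
apply: eq_bigr => c _; rewrite !lift0 mulrzA natE -pmulrn.
by rewrite -!mulrnA; congr (_ *+ _); rewrite mulnS expnD; ring.
Qed.

(** The action along the circle powers $a^{\circ p^k t}$ is averaged in two ways:
    by the chain rule, and through its expansion in powers of $L_a$. *)
Lemma linear_part_log_elt v :
  linear_part p n k circ gamma log_elt v = log_act v *+ (p.-1 * p ^ k).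
Proof.
have HR : analytic p k 2 0 (rest a).
  apply: analytic_sum => i _; apply: analytic_sum => c _.
  by apply: analytic_mono => //; rewrite maxn0; exists (pow_div_fact i a *~ stirling1 i.+1 c.+2).
rewrite -(avg_Phi adm expk gamma_prim log_elt v HR).
rewrite (@avg_ext _ _ _ _ _ (fun t => log_act v *+ p ^ k *+ t + rest (L v) t *+ p ^ k)).
  rewrite avgD (avg_linear adm gamma_prim) mulnC mulrnA.
  have HE : analytic_op p k 2 0 (fun t w => rest (L w) t *+ p ^ k).
    apply: (analytic_op_ext (F := fun t w => \sum_(i < K) \sum_(c < i)
      (pow_div_fact i (L w) *~ stirling1 i.+1 c.+2) *+ p ^ (k * c.+2) *+ t ^ c.+2)).
      move=> t w; rewrite /rest -sumrMnl; apply: eq_bigr => i _.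
      rewrite -sumrMnl; apply: eq_bigr => c _.
      by rewrite -!mulrnA; congr (_ *+ _); rewrite [(k * c.+2)%N]mulnS expnD; ring.
    apply: analytic_op_sum => i _; apply: analytic_op_sum => c _; apply: analytic_op_mono => //.
    have eD : addf (fun w => pow_div_fact i (L w)) by move=> x y; rewrite LD (pow_div_fact_addf n LD FL).
    by have := Fil_pMn (k * c.+2) (FilMz (stirling1 i.+1 c.+2) (Fil0 p eD)); rewrite maxn0 addn0.
  by rewrite (avg_analytic_op adm expk gamma_prim v HE) addr0.
move=> t; rewrite /Phi -[X in star circ X v](_ : circ_pow circ a (p ^ k * t) = _); last first.
  by rewrite (circ_powE adm) pow_expansion.
rewrite (star_circ_pow adm) (eq_bigr (fun i : 'I__ => iter i L (L v) *+ 'C(p ^ k * t, i.+1))); last first.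
  by move=> i _; rewrite -iterSr.
rewrite pow_expansion mulrnDl; congr (_ + _).
by rewrite (log_div_L n LD FL) mulrnAC.
Qed.

End Logarithm.

(** * Quotients by annihilators *)

Section Quotients.
Variable G : finZmodType.
Implicit Types (N M : nat).

Lemma cls_addf N : addf (@cls G N). Proof. exact: clsD. Qed.

Lemma clsP N (a b : G) : cls N a = cls N b <-> (a - b) *+ N = 0.
Proof. by split=> [/eqP|e]; [rewrite cls_eq => /eqP|apply/eqP; rewrite cls_eq e]. Qed.

Lemma rep_cls N (a : G) : (rep (cls N a) - a) *+ N = 0.
Proof. by apply/clsP; rewrite repK. Qed.

Lemma exists_division_function N d :
  exists rho : quot_ann G N -> quot_ann G N, division_function d rho.
Proof.
exists (fun z => cls N (odflt 0 [pick y : G | z == cls N y *+ d])) => z [u uE].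
case: pickP => [y /eqP -> //|/(_ (rep u))]; by rewrite repK uE eqxx.
Qed.

(** A permutation of a quotient extends to [G] through the canonical
    representatives, so one exponent that depends on [G] only serves all of
    them. *)
Lemma iter_quot_inj N (o : quot_ann G N -> quot_ann G N) u :
  injective o -> iter #|[set: {perm G}]| o u = u.
Proof.
move=> o_inj.
pose h (x : G) := if x == rep (cls N x) then rep (o (cls N x)) else x.
have repI : injective (@rep G N) := can_inj (@repK G N).
have h_inj : injective h.
  move=> x y; rewrite /h; case: eqP => [xE|xE]; case: eqP => [yE|yE] //.
  - by move/repI/o_inj => e; rewrite xE yE e.
  - by move=> e; case: yE; rewrite -e repK.
  - by move=> e; case: xE; rewrite e repK.
have hrep v : h (rep v) = rep (o v) by rewrite /h repK eqxx.
apply: repI; set M := #|_|.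
have hiter i v : iter i (perm h_inj) (rep v) = rep (iter i o v).
  by elim: i => //= i ->; rewrite permE hrep.
rewrite -hiter -permX /M.
by rewrite (expg_cardG (in_setT _ : perm h_inj \in [set: {perm G}]%G)) perm1.
Qed.

End Quotients.

Section BraceQuotient.
Variables (p n : nat) (G : finZmodType) (circ : G -> G -> G).
Hypothesis adm : admissible p n circ.

(** By [star_ann] the annihilator of $p^i$ is an ideal. *)
Lemma cls_circ i : {morph @cls G (p ^ i) : a b / circ a b >-> quot_circ circ a b}.
Proof.
move=> a b; apply/esym/clsP.
have c0 := rep_cls (p ^ i) a; have d0 := rep_cls (p ^ i) b.
set a' := rep _ in c0 *; set b' := rep _ in d0 *.
have [z [zE _ _ /(_ _ c0) z0]] := circ_solve adm a (a' - a).
have -> : a' = circ a z by rewrite zE subrKC.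
rewrite -(circA adm).
have -> : circ z b' = b + (z + (b' - b) + star circ z b').
  by rewrite (circE circ) /lam [RHS]addrA [b + _]addrCA (subrKC b) -(addrA z b').
rewrite (circE circ) (lamD adm) addrA -(circE circ) addrAC subrr add0r.
rewrite -(addfMn (lamD adm a)) mulrnDl mulrnDl z0 d0 (star_ann adm _ z0) !addr0.
by rewrite (addf0 (lamD adm a)).
Qed.

Lemma cls_star i a b : cls (p ^ i) (star circ a b) =
  star (@quot_circ G circ (p ^ i)) (cls (p ^ i) a) (cls (p ^ i) b).
Proof. by rewrite /star !(addfB (@cls_addf _ _)) cls_circ. Qed.

Lemma brace_quot i : is_brace (@quot_circ G circ (p ^ i)).
Proof.
have cc := cls_circ i; pose c := @cls G (p ^ i).
split; first split.
- move=> u v w; rewrite -(repK u) -(repK v) -(repK w) -!cc (circA adm) //.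
- exists (c 0); split=> [u|u|u].
  + by rewrite -(repK u) -cc (circ0l adm).
  + by rewrite -(repK u) -cc (circ0r adm).
  have [b [ba ab]] := circV adm (rep u); exists (c b).
  by rewrite -(repK u) -!cc ba ab.
move=> u v w; rewrite -(repK u) -(repK v) -(repK w) -clsD -!cc -!clsD.
by rewrite (brace_compat (adm_brace adm)).
Qed.

End BraceQuotient.

Section PreLie.
Variables (p n k : nat) (G : finZmodType) (circ : G -> G -> G) (gamma : int).
Hypothesis adm : admissible p n circ.
Hypothesis expk : forall x : G, x *+ p ^ (k * p.-1) = 0.
Hypothesis gamma_prim : primitive_root_mod (p ^ n) gamma.
Variable wpinv : G -> G.
Hypothesis wpinvP : division_function (p ^ k) wpinv.
Notation cl := (cls (p ^ (2 * k))).
Notation D := (linear_part p n k circ gamma).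
Notation Phi := (Phi p k circ).
Notation xi := (gamma ^+ (p ^ n.-1)).
Notation mul := (@bullet p k xi G circ wpinv).
Local Opaque star.

Let divPhi x y : divisible (p ^ k) (Phi x y).
Proof.
have d1 : divisible (p ^ (k * 0)) x by rewrite muln0; exists x.
by have [_ /(_ y)] := Fil_Phi adm d1; rewrite muln1.
Qed.

(** A change of [x] by an element of $ann(p^{2k})$ composes the action of
    $p^k x$ with that of an element of $ann(p^k)$, to which [star_ann]
    applies. *)
Lemma odot_cls x y :
  odot circ wpinv (cl x) (cl y) = cl (wpinv (star circ (x *+ p ^ k) y)).
Proof.
rewrite /odot; apply/clsP; rewrite -!/(Phi _ _).
have c0 := rep_cls (p ^ (2 * k)) x; have d0 := rep_cls (p ^ (2 * k)) y.
set x' := rep _ in c0 *; set y' := rep _ in d0 *.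
rewrite mul2n -addnn expnD in c0 d0 *.
rewrite mulrnA mulrnBl !wpinvP; try exact: divPhi.
have [z [_ zE _ /(_ _ c0) z0]] := circ_solve adm (x *+ p ^ k) (x' - x).
have -> : Phi x' y' = Phi x y' + Phi z y' + Phi x (Phi z y').
  by rewrite -(Phi_add k adm) /Phi -zE subrKC.
have Pz : Phi z y' *+ p ^ k = 0 by apply: (star_ann adm); rewrite -mulrnA.
have BC : (Phi z y' + Phi x (Phi z y')) *+ p ^ k = 0.
  by rewrite mulrnDl Pz -(addfMn (PhiD k adm x)) Pz (addf0 (PhiD k adm x)) addr0.
rewrite -(addrA (Phi x y')) (addrC (Phi x y')) -(addrA _ (Phi x y')) mulrnDl BC add0r.
rewrite -(addfB (PhiD k adm x)).
have d1 : divisible (p ^ (k * 0)) x by rewrite muln0; exists x.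
by have [_ _] := Fil_Phi adm d1; rewrite muln1; apply; rewrite expnD.
Qed.

Lemma mul_cls x y r : r *+ p ^ k = D x y -> mul (cl x) (cl y) = cl r.
Proof.
move=> rE; rewrite /bullet.
have V0 := order_killed adm; have p_pr := adm_prime adm.
have clz (v : G) i : cl v *~ (xi ^+ i) = cl (v *+ unity_rep p n gamma i).
  rewrite -(addfMz (@cls_addf _ _)); congr (cl _).
  by rewrite pmulrn; apply: (mulrz_mod V0); rewrite unity_repE.
under eq_bigr => i _ do rewrite clz odot_cls clz.
rewrite -(addf_sum (@cls_addf _ _)); apply/clsP.
rewrite mul2n -addnn expnD mulrnA mulrnBl rE -sumrMnl.
rewrite [X in X - _](_ : _ = D x y) ?subrr ?mul0rn //.
by apply: eq_bigr => i _; rewrite mulrnAC wpinvP //; apply: divPhi.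
Qed.

Let D_ex x y : exists r, r *+ p ^ k = D x y.
Proof.
have d1 : divisible (p ^ (k * 0)) x by rewrite muln0; exists x.
have [_ /(_ y)[r rE] _] := Fil_linear_part gamma adm d1.
by exists r; rewrite rE muln1.
Qed.

(** The map $[r] \mapsto p^{2k} r$ from $P$ to $G$ is injective and turns the
    axioms into identities between linear parts: every product absorbs one
    factor $p^k$. *)
Lemma pre_lie_bullet : is_pre_lie_ring mul.
Proof.
have DDl := linear_partDl adm expk gamma_prim; have DDr := linear_partDr k gamma adm.
have split2 (r s : G) : r *+ p ^ k *+ p ^ k = s *+ p ^ k *+ p ^ k -> cl r = cl s.
  by move=> e; apply/clsP; rewrite mul2n -addnn expnD mulrnA !mulrnBl e subrr.
split=> u v w; rewrite -(repK u) -(repK v) -(repK w);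
  move: (rep u) (rep v) (rep w) => x y z.
- have [r rE] := D_ex x z; have [s sE] := D_ex y z.
  rewrite -clsD (mul_cls rE) (mul_cls sE) -clsD; apply: mul_cls.
  by rewrite mulrnDl rE sE DDl.
- have [r rE] := D_ex x y; have [s sE] := D_ex x z.
  rewrite -clsD (mul_cls rE) (mul_cls sE) -clsD; apply: mul_cls.
  by rewrite mulrnDl rE sE DDr.
have [xy xyE] := D_ex x y; have [yx yxE] := D_ex y x.
have [yz yzE] := D_ex y z; have [xz xzE] := D_ex x z.
have [r1 r1E] := D_ex xy z; have [r2 r2E] := D_ex x yz.
have [r3 r3E] := D_ex yx z; have [r4 r4E] := D_ex y xz.
rewrite (mul_cls xyE) (mul_cls yxE) (mul_cls yzE) (mul_cls xzE).
rewrite (mul_cls r1E) (mul_cls r2E) (mul_cls r3E) (mul_cls r4E).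
rewrite -!(addfB (@cls_addf _ _)); apply: split2.
rewrite !mulrnBl r1E r2E r3E r4E -(linear_partMnl adm expk gamma_prim xy) -(linear_partMnl adm expk gamma_prim yx)
  -(addfMn (DDr x)) -(addfMn (DDr y)).
rewrite xyE yzE yxE xzE -[LHS]opprB -[RHS]opprB.
by rewrite (linear_part_symmetric adm expk gamma_prim).
Qed.

Notation loga := (log_act p n circ).

Lemma mul_log_elt a v :
  mul (cl (log_elt p n circ a)) (cl v) = cl (loga a v *+ p.-1).
Proof.
by apply: mul_cls; rewrite (linear_part_log_elt adm expk gamma_prim) mulrnA.
Qed.

End PreLie.

(** * The formal term *)

Section Terms.
Variables (p n m : nat).

(** Multiplication by [c]; adding [p ^ n] copies makes it work for [c = 0]. *)
Definition scaleT c t := iter (c + p ^ n).-1 (AddP t) t.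

(** The product of [X] and [Z] divided by $p - 1$; for [X] the logarithm of [a]
    it is the action of $\log(1 + L_a)$ on [Z]. *)
Definition logT X Z := scaleT (invmod (p ^ n)%N p.-1) (MulP X Z).

Definition pow2m_divT X Z := iter m (logT X) (DivP (iter m (logT X) Z)).

Definition exp_coef a : nat :=
  let u : rat := p%:R ^+ (a %/ m.*2) / (a.+1)`!%:R in
  `|numq u| * invmod (p ^ n)%N `|denq u|%N.

(** The operator $(e^T - 1)/T$ in the form [exp_div], for $T$ the multiplication
    by [X] divided by $p - 1$. The fold starts from a term for zero. *)
Definition expT X Z := foldr (fun a t => AddP (scaleT (exp_coef a)
    (iter (a %% m.*2) (logT X) (iter (a %/ m.*2) (pow2m_divT X) Z))) t)
  (scaleT 0 Z) (iota 0 (m.*2 * n)).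

(** If [M] is an exponent for the permutations of $P$, the $(M - 1)$-st power of
    the inverse of the logarithm is the logarithm. *)
Definition powT M := iter M.-1 (fun X => expT X X) VarX.

(** $L_a = ((e^T - 1)/T)\, T$ for $T = \log(1 + L_a)$. *)
Definition braceT M := CosetQ (expT (powT M) (logT (powT M) VarY)).

End Terms.

Lemma rat_scale_exp_coef (p n m a : nat) (V : zmodType) (v : V) :
  rat_scale p n (p%:R ^+ (a %/ m.*2) / (a.+1)`!%:R) v = v *+ exp_coef p n m a.
Proof.
have : 0 <= numq (p%:R ^+ (a %/ m.*2) / (a.+1)`!%:R : rat).
  by rewrite numq_ge0; apply: divr_ge0; [apply: exprn_ge0|]; apply: ler0n.
rewrite /rat_scale /exp_coef; move: (p%:R ^+ _ / _ : rat) => u u0.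
by rewrite mulrnA; congr (_ *+ _); rewrite [RHS]pmulrn gez0_abs.
Qed.

Section Evaluation.
Variables (p n k : nat) (G : finZmodType) (circ : G -> G -> G) (gamma : int).
Hypothesis adm : admissible p n circ.
Hypothesis expk : forall x : G, x *+ p ^ (k * p.-1) = 0.
Hypothesis gamma_prim : primitive_root_mod (p ^ n) gamma.
Variable wpinv : G -> G.
Hypothesis wpinvP : division_function (p ^ k) wpinv.
Notation cl := (cls (p ^ (2 * k))).
Notation P := (quot_ann G (p ^ (2 * k))).
Notation xi := (gamma ^+ (p ^ n.-1)).
Notation mul := (@bullet p k xi G circ wpinv).
Notation loge := (log_elt p n circ).
Notation loga := (log_act p n circ).
Notation m := (p.-1 %/ 4)%N.
Notation M := #|[set: {perm G}]|.
Local Opaque star.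
Let p_pr := adm_prime adm.
Let V0 := order_killed adm.
Let m0 := adm_m_gt0 adm.
Let LD a : addf (star circ a) := starD adm a.
Let FL a : Fil p 1 (iter m (star circ a)) := Fil_star_m adm a.
Let laD a : addf (loga a) := log_op_addf n (LD a) (FL a).
Let Fla a : Fil p 1 (iter m (loga a)) := Fil_log_op n (LD a) (FL a).

Section Values.
Variables (rhoP : P -> P) (x y : P).
Hypothesis rhoPP : division_function p rhoP.

Definition denotes t (v : G) := definedP p mul rhoP x y t /\ Defs.valP mul rhoP x y t = cl v.

Lemma denotes_scale c t v : denotes t v -> denotes (scaleT p n c t) (v *+ c).
Proof.
move=> [dt vt]; have p0 : (0 < p ^ n)%N by rewrite expn_gt0 prime_gt0.
have d0 : definedP p mul rhoP x y (scaleT p n c t).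
  by rewrite /scaleT; elim: (c + p ^ n)%N.-1 => //= i IH.
split=> //.
have -> : v *+ c = v *+ (c + p ^ n) by rewrite mulrnDr V0 addr0.
rewrite /scaleT -[in RHS](@prednK (c + p ^ n)) ?addn_gt0 ?p0 ?orbT //.
elim: (c + p ^ n)%N.-1 => [|i IH] /=; first by rewrite vt mulr1n.
by rewrite IH vt -clsD -mulrS.
Qed.

Lemma denotes_log X a t v : denotes X (loge a) -> denotes t v ->
  denotes (logT p n X t) (loga a v).
Proof.
move=> [dX vX] [dt vt]; rewrite /logT.
have cp : coprime p.-1 p.
  have p1 := prime_gt1 p_pr.
  by rewrite coprime_sym prime_coprime // gtnNdvd //; move: p1; case: (p) => [|[]].
have -> : loga a v = loga a v *+ p.-1 *+ invmod (p ^ n)%N p.-1.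
  by rewrite -mulrnA (invmodP p_pr V0).
apply: denotes_scale; split=> //=.
by rewrite vX vt (mul_log_elt adm expk gamma_prim wpinvP).
Qed.

Lemma denotes_iter_log X a i t v : denotes X (loge a) -> denotes t v ->
  denotes (iter i (logT p n X) t) (iter i (loga a) v).
Proof. by move=> HX Ht; elim: i => //= i IH; apply: denotes_log. Qed.

(** The result of the division is ambiguous up to elements of order [p] in the
    quotient, and these are killed by the last [m] applications. *)
Lemma denotes_split X a t v : denotes X (loge a) -> denotes t v ->
  denotes (pow2m_divT p n m X t) (pow2m_div p m (loga a) v).
Proof.
move=> HX Ht; rewrite /pow2m_divT.
have [d1 v1] := denotes_iter_log m HX Ht.
have [u uE ->] := pow2m_div_div (laD a) (Fla a) v.
set t1 := iter m (logT p n X) t in d1 v1 *.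
have dv : divisible p (Defs.valP mul rhoP x y t1).
  by rewrite v1 -uE; exists (cl u); apply: (addfMn (@cls_addf _ _)).
pose z := rep (rhoP (Defs.valP mul rhoP x y t1)).
have Hz : denotes (DivP t1) z by split=> //=; rewrite /z repK.
have [d2 v2] := denotes_iter_log m HX Hz; split=> //; rewrite v2.
apply/clsP; rewrite -(addfB (addf_iter m (laD a))).
have [_ _] := Fla a; apply.
have : cl (z *+ p) = cl (u *+ p).
  by rewrite (addfMn (@cls_addf _ _)) /z repK rhoPP // v1 uE.
by move/clsP; rewrite -mulrnBl -mulrnA addn1 expnS.
Qed.

Lemma denotes_exp X a t v : denotes X (loge a) -> denotes t v ->
  denotes (expT p n m X t) (exp_div p n m (loga a) v).
Proof.
move=> HX Ht; rewrite /expT /exp_div -(big_mkord xpredT (fun i => rat_scale p n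
  (p%:R ^+ (i %/ m.*2) / (i.+1)`!%:R) (iter (i %% m.*2) (loga a)
    (iter (i %/ m.*2) (pow2m_div p m (loga a)) v)))) /index_iota subn0.
elim: (iota _ _) => [|i s IH] /=.
  by rewrite big_nil -(mulr0n v); apply: denotes_scale.
rewrite big_cons; have H : denotes (iter (i %/ m.*2) (pow2m_divT p n m X) t)
    (iter (i %/ m.*2) (pow2m_div p m (loga a)) v).
  by elim: (i %/ m.*2)%N => //= j IHj; apply: denotes_split.
have [d1 v1] := denotes_scale (exp_coef p n m i) (denotes_iter_log (i %% m.*2) HX H).
have [d2 v2] := IH; split; first by split.
by rewrite -[LHS]/(Defs.valP mul rhoP x y _ + Defs.valP mul rhoP x y _) v1 v2 -clsD -rat_scale_exp_coef.
Qed.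

Lemma denotes_exp_self X a : denotes X (loge a) -> denotes (expT p n m X X) a.
Proof.
move=> HX; have := denotes_exp HX HX.
by rewrite (exp_log_div p_pr V0 m0 (leq_double_quarter p) (LD a) (FL a)).
Qed.

End Values.

Let o (u : P) : P := cl (loge (rep u)).

Let o_inj : injective o.
Proof.
have [rho rhoP] := exists_division_function G (p ^ (2 * k)) p.
move=> u v uv.
have Hu : denotes rho (o u) (o u) VarX (loge (rep u)) by [].
have Hv : denotes rho (o u) (o u) VarX (loge (rep v)) by split=> //=; rewrite uv.
have [_ vu] := denotes_exp_self rhoP Hu; have [_ vv] := denotes_exp_self rhoP Hv.
by rewrite -(repK u) -(repK v) -vu -vv.
Qed.

Let iter_o u : iter M o u = u. Proof. exact: iter_quot_inj. Qed.

Let M_gt0 : (0 < M)%N. Proof. by rewrite cardG_gt0. Qed.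

(** An injective map of a finite group to itself is surjective, and
    [denotes_exp_self] recovers an element from its logarithm. *)
Lemma log_elt_surj u : exists a, u = cl (loge a).
Proof.
by exists (rep (iter M.-1 o u)); rewrite -[LHS]iter_o -(prednK M_gt0) iterS.
Qed.

Lemma denotes_pow rhoP x y : division_function p rhoP ->
  denotes rhoP x y (powT p n m M) (loge (rep x)).
Proof.
move=> rhoPP; rewrite /powT.
suff H j : (j < M)%N -> denotes rhoP x y
    (iter j (fun X => expT p n m X X) VarX) (rep (iter (M - j) o x)).
  have lt_M : (M.-1 < M)%N by rewrite prednK.
  have [d v] := H _ lt_M; split=> //; rewrite v repK (_ : M - M.-1 = 1)%N //.
  by move: M_gt0; case: (M) => // q _; rewrite subSnn.
elim: j => [|j IH] jM; first by split=> //=; rewrite subn0 repK iter_o.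
rewrite [iter j.+1 _ _]iterS.
have jM' := ltnW jM; have [d v] := IH jM'.
have H : denotes rhoP x y (iter j (fun X => expT p n m X X) VarX)
    (loge (rep (iter (M - j.+1) o x))).
  by split=> //; rewrite v repK -[(M - j)%N](subnSK jM') iterS.
exact: denotes_exp_self.
Qed.

(** Modulo [p], $\log(1 + L_a)$ is a polynomial in $L_a$ without constant term,
    so it goes down the flag; each passage through the whole flag gains a
    factor [p]. *)
Lemma left_nilpotent_bullet : left_nilpotent mul.
Proof.
have [U [r [U0 Ur Us Udec UL]]] := star_flag adm.
have step a i u : U i u -> exists2 w, U i.+1 w & divisible p (loga a u - w).
  move=> Ui; have [ui us] := Us i.
  have ULi z : U i z -> U i (star circ a z) by move/(UL _ a)/Udec.
  have [w Uw [z zE]] := log_div_stable n m0 (LD a) (FL a) ui us ULi Ui.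
  exists (star circ a w); first exact: UL.
  exists (star circ a z); rewrite -(addfMn (LD a)) -zE (addfB (LD a)).
  by [].
have one e (s : seq P) v : exists u w, U (size s) u /\
    foldr mul (cl (v *+ p ^ e)) s = cl ((u + w *+ p) *+ p ^ e).
  elim: s => [|b s [u [w [Uu IH]]]] /=.
    by exists v, 0; split; [apply: U0|rewrite mul0rn addr0].
  have [a ->] := log_elt_surj b; rewrite IH (mul_log_elt adm expk gamma_prim wpinvP).
  have [u' Uu' [w' w'E]] := step a _ _ Uu.
  have UMn i z d : U i z -> U i (z *+ d).
    have [z0 zs] := Us i => Uz; elim: d => [|d IHd] //.
    rewrite mulrS -[z *+ d]opprK; apply: (zs) => //.
    by rewrite -[- _]add0r; apply: zs.
  exists (u' *+ p.-1), ((w' + loga a w) *+ p.-1); split; first exact: UMn.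
  congr (cl _); rewrite (addfMn (laD a)) laD (addfMn (laD a)) mulrnAC; congr (_ *+ _).
  rewrite -(subrK u' (loga a u)) w'E.
  rewrite [in RHS]mulrnAC -[RHS]mulrnDl; congr (_ *+ _).
  by rewrite (mulrnDl _ w') (addrA u') (addrC u').
exists (r * n)%N => s x.
suff H e : forall t : seq P, size t = (r * e)%N -> exists w, foldr mul x t = cl (w *+ p ^ e).
  have [w ->] := H n s (size_tuple s); rewrite V0; exact: (addf0 (@cls_addf _ _)).
elim: e => [|e IH] t st.
  exists (rep x); move: st; rewrite muln0 => /size0nil ->.
  by rewrite /= expn0 mulr1n repK.
rewrite -(cat_take_drop r t) foldr_cat.
have [|w ->] := IH (drop r t); first by rewrite size_drop st mulnS addKn.
have [u [w' [Uu ->]]] := one e (take r t) w.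
rewrite size_takel in Uu; last by rewrite st mulnS leq_addr.
by exists w'; rewrite (Ur _ Uu) add0r -mulrnA -expnS.
Qed.

Lemma braceT_correct (rhoP : P -> P) (Q := quot_ann G (p ^ (4 * k))) (rhoQ : Q -> Q) (x y : P)
    (proj : P -> Q := @coset G (p ^ (2 * k)) (p ^ (4 * k))) :
  division_function p rhoP ->
  definedQ p mul proj rhoP rhoQ x y (braceT p n m M) /\
  star (@quot_circ G circ (p ^ (4 * k))) (proj x) (proj y) =
    valQ mul proj rhoP rhoQ x y (braceT p n m M).
Proof.
move=> rhoPP; have Hw := denotes_pow x y rhoPP.
have Hy : denotes rhoP x y VarY (rep y) by split=> //=; rewrite repK.
have [d v] := denotes_exp rhoPP Hw (denotes_log Hw Hy).
split=> //=; rewrite v.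
rewrite /log_act /log_op -(log_div_L n (LD _) (FL _)).
rewrite (exp_log_div p_pr V0 m0 (leq_double_quarter p) (LD _) (FL _)).
rewrite /proj coset_cls; last by rewrite dvdn_exp2l // leq_mul2r orbT.
by rewrite (cls_star adm).
Qed.

End Evaluation.

(** * The brace from its pre-Lie ring *)

Section Trivial.
Variables (p : nat) (P Q : zmodType) (mul : P -> P -> P) (proj : P -> Q).
Variables (rhoP : P -> P) (rhoQ : Q -> Q) (x y : P).
Hypothesis P0 : forall u v : P, u = v.
Hypothesis Q0 : forall u v : Q, u = v.

Lemma definedQ_trivial t : definedQ p mul proj rhoP rhoQ x y t.
Proof.
have HP s : definedP p mul rhoP x y s.
  elim: s => //= s Hs; split=> //; exists 0; exact: P0.
elim: t => //= t Ht; split=> //; exists 0; exact: Q0.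
Qed.

End Trivial.

Theorem theorem1 (p n k : nat) (G : finZmodType) (gamma : int)
    (p_prime : prime p) (p_gt2 : (2 < p)%N)
    (cardG : #|G| = (p ^ n)%N)
    (expG : forall x : G, x *+ p ^ (k * (p - 1)) = 0)
    (gamma_prim : primitive_root_mod (p ^ n) gamma) :
  let xi : int := gamma ^+ (p ^ n.-1) in
  let P := quot_ann G (p ^ (2 * k)) in
  let Q := quot_ann G (p ^ (4 * k)) in
  let proj : P -> Q := @coset G (p ^ (2 * k)) (p ^ (4 * k)) in
  exists t : termQ,
  forall circ : G -> G -> G,
    is_brace circ -> property1' p circ -> property1'' p circ ->
  forall wpinv : G -> G, division_function (p ^ k) wpinv ->
  let mul : P -> P -> P := bullet xi circ wpinv in
  let circQ : Q -> Q -> Q := @quot_circ G circ (p ^ (4 * k)) in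
  [/\ (* the operation of P is well defined *)
      forall x y : G,
        odot circ wpinv (cls (p ^ (2 * k)) x) (cls (p ^ (2 * k)) y)
        = cls (p ^ (2 * k)) (wpinv (star circ (x *+ p ^ k) y)),
      is_pre_lie_ring mul /\ left_nilpotent mul,
      (* Q is a quotient brace of G *)
      is_brace circQ /\
      {morph @cls G (p ^ (4 * k)) : a b / circ a b >-> circQ a b},
      (* Q = P / ann_P(p^2k), with the induced addition *)
      {morph proj : x y / x + y} /\
      (forall x : P, (proj x == 0) = (x \in ann P (p ^ (2 * k)))) &
      forall (rhoP : P -> P) (rhoQ : Q -> Q),
        division_function p rhoP -> division_function p rhoQ ->
      forall x y : P,
        definedQ p mul proj rhoP rhoQ x y t /\
        star circQ (proj x) (proj y) = valQ mul proj rhoP rhoQ x y t].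
Proof.
move=> xi P Q proj.
exists (braceT p n (p.-1 %/ 4) #|[set: {perm G}]|) => circ br p1 p2 wpinv wpP mul circQ.
have projD : {morph proj : x y / x + y}.
  by apply: cosetD; rewrite dvdn_exp2l // leq_mul2r orbT.
have projK (x : P) : (proj x == 0) = (x \in ann P (p ^ (2 * k))).
  have kerE N : N = (p ^ (2 * k) * p ^ (2 * k))%N ->
      (coset N x == 0) = (x \in ann P (p ^ (2 * k))) by move=> ->; apply: coset_ker.
  by apply: kerE; rewrite -expnD; congr (_ ^ _)%N; lia.
have [m0 | m_gt0] := posnP (p.-1 %/ 4).
  have G0 (x : G) : x = 0.
    have [p1' _] := p1; rewrite m0 /= in p1'.
    have dv i : divisible (p ^ i) x.
      elim: i => [|i [y ->]]; first by exists x.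
      by have [z ->] := p1' 0 y; exists z; rewrite -mulrnA -expnS.
    by have [y ->] := dv n; apply: exp_card.
  have Q0 N (u v : quot_ann G N) : u = v.
    by rewrite -(repK u) -(repK v) (G0 (rep u)) (G0 (rep v)).
  split; [by move=> x y; apply: Q0| | |by []|].
  - split; first by split=> *; apply: Q0.
    by exists 0%N => s x; apply: Q0.
  - split; last by move=> a b; apply: Q0.
    split; last by move=> *; apply: Q0.
    split; first by move=> *; apply: Q0.
    exists 0; split=> [u|u|u]; [exact: Q0|exact: Q0|].
    by exists 0; split; apply: Q0.
  - move=> rhoP rhoQ _ _ x y; split; last exact: Q0.
    by apply: definedQ_trivial; apply: Q0.
have adm : admissible p n circ by split.
have expk (x : G) : x *+ p ^ (k * p.-1) = 0 by rewrite -subn1.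
split=> [x y||||rhoP rhoQ rP _ x y]; last 1 first.
- exact (braceT_correct adm expk gamma_prim wpP rhoQ x y rP).
- exact (odot_cls adm wpP x y).
- split; first exact (pre_lie_bullet adm expk gamma_prim wpP).
  exact (left_nilpotent_bullet adm expk gamma_prim wpP).
- by split; [exact (brace_quot adm _)|exact (cls_circ adm _)].
by [].
Qed.
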